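(* Let $T,\theta,R>0$ and $\alpha>1$, and let $\gamma_t$ be a discount function satisfying the assumptions (i)-(iv) listed in the context. Let $$\Gamma_t(s):=\int\gamma_t(s)^{-\frac{1}{\alpha-1}}\,ds$$ (an antiderivative in $s$, defined up to an additive constant; only differences $\Gamma_t(s_1)-\Gamma_t(s_2)$ are used), and let $$\zeta(t):=\gamma_t(T)\,\bigl(\Gamma_t(T)-\Gamma_t(t)\bigr)^{\alpha-1}.$$ Assume that $\zeta(t)$ is non-increasing on $[0,T]$. Then the agent's trajectory (defined in the context) is given by $$x(t)=\theta\left(1-\exp\left(-\int_0^{\min\{t,t^*\}}\frac{ds}{\Gamma_s(T)-\Gamma_s(s)}\right)\right),$$ where $t^*$ is defined as follows: if there exists $t\in[0,T]$ such that $$\frac{\exp\left(-\alpha\int_0^t\frac{ds}{\Gamma_s(T)-\Gamma_s(s)}\right)}{\zeta(t)}>\frac{R}{\theta^\alpha},$$ then $t^*$ is the infimum of all such $t$; otherwise, $t^*=T$.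
   Context: An agent receives a reward $R$ if its progress reaches the goal $\theta$ within the period $[0,T]$. The agent's state is $(t,x)$, with time $t\in[0,T]$ and progress $x\ge0$. Assumptions on the discount function $\gamma_t$ (with values in $(0,1]$): (i) $\gamma_t(s)$ is continuously differentiable on $[t,T]$; (ii) $(t,s)\mapsto\gamma_t(s)$ is continuous on $\{(t,s):0\le t\le s\le T\}$; (iii) $\gamma_t(s)$ is non-increasing on $[t,T]$; (iv) $\gamma_t(t)=1$. Cost function: $c(\Delta)=\Delta^\alpha$ if $\Delta\ge0$ and $c(\Delta)=+\infty$ otherwise. $\mathcal Y_{t,x}$ is the set of absolutely continuous functions $y$ on $[t,T]$ with $y(t)=x$. The perceived cost of $y\in\mathcal Y_{t,x}$ is $$\mathcal P[y]=\int_t^T\gamma_t(s)\,c(y'(s))\,ds-\gamma_t(T)\,R\cdot\mathbf 1[y(T)\ge\theta].$$ At state $(t,x)$ the agent selects $y^*_{t,x}:=\operatorname{argmin}_{y\in\mathcal Y_{t,x}}\mathcal P[y]$; if the minimizer is not unique, one that maximizes the initial derivative $\left.\frac{d\,y^*_{t,x}(s)}{ds}\right|_{s=t}$ is chosen. The agent's trajectory $x(t)$, $t\in[0,T]$, is determined by $$\frac{dx(t)}{dt}=\left.\frac{d\,y^*_{t,x(t)}(s)}{ds}\right|_{s=t},\qquad x(0)=0.$$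
   Formalization: The trajectory equation is required only for almost every t (x absolutely continuous), since it fails at t* when 0<t*<T; as such solutions need not be unique when ties occur, the agent's trajectory is taken to be the greatest solution. *)

(* Defs.v *)
From HB Require Import structures.
From mathcomp Require Export all_boot all_order all_algebra.
From mathcomp Require Export all_classical all_reals all_analysis.
Export numFieldNormedType.Exports.
Import Order.TTheory GRing.Theory Num.Theory.

Set Implicit Arguments.
Unset Strict Implicit.
Unset Printing Implicit Defensive.

Local Open Scope classical_set_scope.
Local Open Scope ring_scope.

(* Two-sided at interior points of A, one-sided at the endpoints of an
   interval A. *)
Definition has_derivative_within (R : realType) (A : set R) (f : R -> R)
    (s l : R) : Prop :=
  (f u - f s) / (u - s) @[u --> within A s^'] --> l.

Definition continuously_differentiable_on (R : realType) (a b : R)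
    (f : R -> R) : Prop :=
  exists2 g : R -> R,
    {within `[a, b], continuous g} &
    forall s : R, a <= s <= b -> has_derivative_within `[a, b] f s (g s).

Definition absolutely_continuous_on (R : realType) (a b : R) (f : R -> R)
    : Prop :=
  forall e : R, 0 < e -> exists2 d : R, 0 < d &
    forall (n : nat) (l u : 'I_n -> R),
      (forall i, [&& a <= l i, l i <= u i & u i <= b]) ->
      trivIset setT (fun i => `]l i, u i[%classic) ->
      \sum_(i < n) (u i - l i) < d ->
      \sum_(i < n) `|f (u i) - f (l i)| < e.

(* [gam t s] is the discount factor gamma_t(s); its values matter only for
   0 <= t <= s <= T. *)
Record discount_function (R : realType) (T : R) (gam : R -> R -> R) : Prop :=
  DiscountFunction {
    discount_range : forall t s : R, 0 <= t -> t <= s -> s <= T ->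
      0 < gam t s <= 1;
    discount_C1 : forall t : R, 0 <= t <= T ->
      continuously_differentiable_on t T (gam t);
    discount_continuous :
      {within [set p : R * R | [&& 0 <= p.1, p.1 <= p.2 & p.2 <= T]],
        continuous (fun p : R * R => gam p.1 p.2)};
    discount_nonincreasing : forall t s s' : R, 0 <= t -> t <= s -> s <= s' ->
      s' <= T -> gam t s' <= gam t s;
    discount_diag : forall t : R, 0 <= t <= T -> gam t t = 1
  }.

Definition cost (R : realType) (alpha v : R) : \bar R :=
  if 0 <= v then (v `^ alpha)%:E else +oo%E.

Definition plan (R : realType) (T t x : R) (y : R -> R) : Prop :=
  absolutely_continuous_on t T y /\ y t = x.

(* [derive1 y s] is meaningful for almost every s since y is absolutely continuous;
   the integrand is nonnegative, so the integral is defined in [0, +oo]. *)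
Definition perceived_cost (R : realType) (T theta r alpha : R)
    (gam : R -> R -> R) (t : R) (y : R -> R) : \bar R :=
  (\int[lebesgue_measure]_(s in `[t, T]) ((gam t s)%:E * cost alpha (derive1 y s))
   - (gam t T * r * (theta <= y T)%R%:R)%:E)%E.

Definition optimal_plan (R : realType) (T theta r alpha : R)
    (gam : R -> R -> R) (t x : R) (y : R -> R) : Prop :=
  plan T t x y /\
  forall z, plan T t x z ->
    (perceived_cost T theta r alpha gam t y
       <= perceived_cost T theta r alpha gam t z)%E.

Definition initial_derivative (R : realType) (t : R) (y : R -> R) (d : R)
    : Prop :=
  (y s - y t) / (s - t) @[s --> t^'+] --> d.

(* The plan y, of initial derivative d, is one the agent may select at state
   (t, x): it is optimal, and d is greatest among the initial derivatives of
   the optimal plans. *)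
Definition selected_plan (R : realType) (T theta r alpha : R)
    (gam : R -> R -> R) (t x : R) (y : R -> R) (d : R) : Prop :=
  [/\ optimal_plan T theta r alpha gam t x y,
      initial_derivative t y d &
      forall z d', optimal_plan T theta r alpha gam t x z ->
        initial_derivative t z d' -> d' <= d].

(* The right-hand side of the equation jumps when the agent abandons the goal,
   and the trajectory has a kink there: solutions are in the sense of
   Caratheodory. *)
Definition follows_selected_plans (R : realType) (T theta r alpha : R)
    (gam : R -> R -> R) (x : R -> R) : Prop :=
  [/\ absolutely_continuous_on 0 T x, x 0 = 0 &
      {ae (@lebesgue_measure R), forall t : R, 0 < t < T ->
        exists (y : R -> R) (d : R),
          selected_plan T theta r alpha gam t (x t) y d /\
          is_derive t 1 x d}].

(* A tie between optimal plans may occur at a single instant, which an equation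
   holding almost everywhere does not see: with gam = 1 and
   theta ^ alpha = r * T ^ (alpha - 1), never starting is also a Caratheodory
   solution, although at time 0 the tie-breaking rule selects the plan that
   reaches the goal.  Requiring the equation at every t instead leaves no
   solution at all when the goal is abandoned at some time in (0, T), since a
   tie occurs then.  Hence ties are resolved in favour of larger derivatives for
   trajectories too: the agent's trajectory is the greatest solution. *)
Definition agent_trajectory (R : realType) (T theta r alpha : R)
    (gam : R -> R -> R) (x : R -> R) : Prop :=
  follows_selected_plans T theta r alpha gam x /\
  forall z, follows_selected_plans T theta r alpha gam z ->
    forall t : R, 0 <= t <= T -> z t <= x t.

(* [Gam t] is an antiderivative of gam_t ^ (-1 / (alpha - 1)) on [t, T]. *)
Definition discount_antiderivative (R : realType) (T alpha : R)
    (gam Gam : R -> R -> R) : Prop :=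
  forall t s : R, 0 <= t -> t <= s -> s <= T ->
    has_derivative_within `[t, T] (Gam t) s (gam t s `^ (- (alpha - 1)^-1)).

Definition zeta (R : realType) (T alpha : R) (gam Gam : R -> R -> R) (t : R)
    : R :=
  gam t T * (Gam t T - Gam t t) `^ (alpha - 1).

(* Extended-real valued: the integral diverges at t = T. *)
Definition rate_integral (R : realType) (T : R) (Gam : R -> R -> R) (t : R)
    : \bar R :=
  (\int[lebesgue_measure]_(s in `[0%R, t]) ((Gam s T - Gam s s)^-1)%:E)%E.

(* At t = T the quotient is 0 / 0 = 0, so T is not in the set; including it
   would not change [abandonment_time]. *)
Definition abandonment_set (R : realType) (T theta r alpha : R)
    (gam Gam : R -> R -> R) : set R :=
  [set t | 0 <= t <= T /\
     r / theta `^ alpha <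
       fine (expeR (- (alpha%:E * rate_integral T Gam t))%E)
         / zeta T alpha gam Gam t].

Definition abandonment_time (R : realType) (T theta r alpha : R)
    (gam Gam : R -> R -> R) : R :=
  let S := abandonment_set T theta r alpha gam Gam in
  if `[< S !=set0 >] then inf S else T.

(* Main.v *)
(* At state (t, x) with u = theta - x > 0, put w = gam_t ^ (-1 / (alpha - 1)),
   D = Gam_t(T) - Gam_t(t), the integral of w over [t, T], and c = u / D.
   Since gam_t w ^ alpha = w, the tangent line of the convex function
   v ^ alpha at c w bounds gam_t(s) cost(v) below by
   alpha c ^ (alpha - 1) v - (alpha - 1) c ^ alpha w(s).  Integrating along a
   plan reaching theta gives the least effort c ^ alpha D, attained by
   y' = c w, whose initial slope is c; it is worth paying if and only if
   u ^ alpha <= r zeta(t).  Using different slopes before and after an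
   intermediate time shows that a plan of least effort never runs ahead of
   y' = c w, which bounds the initial derivative of every optimal plan.
   Absolutely continuous plans are integrals of their derivatives because
   their variation is dominated by the Lebesgue measure (Radon-Nikodym and
   Lebesgue differentiation).

   The gap u of the agent thus satisfies u' = - u / D while
   u ^ alpha <= r zeta(t) and u' = 0 otherwise.  The candidate solves this
   equation: since zeta is non-increasing, once u ^ alpha > r zeta the
   inequality persists.  Conversely every solution stays above the gap of an
   agent who never gives up, and is frozen once it exceeds the threshold, so
   the candidate is the greatest trajectory. *)

From HB Require Import structures.
Require Import Defs.
From mathcomp Require Import ring lra measurable_realfun.
Import Order.TTheory GRing.Theory Num.Theory.
Local Open Scope classical_set_scope.
Local Open Scope ring_scope.

Set Implicit Arguments.
Unset Strict Implicit.
Unset Printing Implicit Defensive.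

(** * Absolutely continuous functions *)

(** Neighbours may share an endpoint, but a degenerate interval inside another one counts as
    overlapping; families of disjoint open intervals are therefore first stripped of their
    degenerate members. *)
Definition nonoverlapping (R : realType) (p q : R * R) : bool :=
  (p.2 <= q.1) || (q.2 <= p.1).

Definition subintervals (R : realType) (a b : R) (s : seq (R * R)) : bool :=
  all (fun p => [&& a <= p.1, p.1 <= p.2 & p.2 <= b]) s &&
  pairwise (@nonoverlapping R) s.

(** Sequences of pairs replace the indexed families of the definition, so that intervals can be
    subdivided, concatenated and filtered. *)
Lemma absolutely_continuous_seq (R : realType) (a b : R) (f : R -> R) :
  absolutely_continuous_on a b f -> forall e, 0 < e ->
  exists2 d, 0 < d & forall s, subintervals a b s ->
    \sum_(p <- s) (p.2 - p.1) < d -> \sum_(p <- s) `|f p.2 - f p.1| < e.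
Proof.
move=> acf e e0; have [d d0 h] := acf e e0; exists d => // s /andP[sab ds] sd.
pose l (i : 'I_(size s)) := (nth (0, 0) s i).1.
pose u (i : 'I_(size s)) := (nth (0, 0) s i).2.
have sumE (F : R * R -> R) :
    \sum_(p <- s) F p = \sum_(i < size s) F (nth (0, 0) s i).
  by rewrite (big_nth (0, 0)) big_mkord.
rewrite sumE in sd; rewrite sumE; apply: (h _ l u) => //.
  by move=> i; apply: (allP sab); rewrite mem_nth.
have noo (i j : 'I_(size s)) x : (i < j)%N -> x \in `]l i, u i[ -> x \in `]l j, u j[ -> False.
  move=> ij; rewrite !in_itv/= => /andP[li ui] /andP[lj uj].
  have /(_ i j) := pairwiseP (0, 0) ds.
  rewrite !inE /= => /(_ (ltn_ord i) (ltn_ord j) ij) /orP[].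
    by rewrite leNgt (lt_trans lj ui).
  by rewrite leNgt (lt_trans li uj).
apply/trivIsetP => i j _ _ ij; rewrite -subset0 => x [xi xj].
by case: (ltngtP i j) ij => [ij _|ij _|/ord_inj -> /eqP//]; [exact: (noo i j x)|exact: (noo j i x)].
Qed.

Lemma absolutely_continuous_uniform (R : realType) (a b : R) (f : R -> R) :
  absolutely_continuous_on a b f -> forall e, 0 < e ->
  exists2 d, 0 < d & forall x y, a <= x <= b -> a <= y <= b ->
    `|x - y| < d -> `|f x - f y| < e.
Proof.
move=> acf e e0; have [d d0 h] := absolutely_continuous_seq acf e0.
exists d => // x y + + ; wlog xy : x y / y <= x => [wl|].
  move=> xab yab; have [/wl|/ltW/wl h'] := leP y x; first exact.
  by rewrite distrC (distrC (f x)); exact: h'.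
move=> /andP[ax xb] /andP[ay yb]; rewrite ger0_norm ?subr_ge0// => xyd.
have := h [:: (y, x)]; rewrite !big_seq1/=; apply => //.
by rewrite /subintervals/= ay xy xb.
Qed.

(** The bridge between a subdivision as a list of points, used by [variation], and a list of
    intervals. *)
Definition cells (R : realType) (a : R) (s : seq R) : seq (R * R) :=
  pairmap pair a s.

Lemma cells_sum_length (R : realType) (a : R) (s : seq R) :
  \sum_(p <- cells a s) (p.2 - p.1) = last a s - a.
Proof.
elim: s a => [a|x s ih a]/=; first by rewrite big_nil subrr.
by rewrite big_cons/= ih; ring.
Qed.

Lemma cells_variation (R : realType) (a b : R) (f : R -> R) (s : seq R) :
  \sum_(p <- cells a s) `|f p.2 - f p.1| = variation a b f s.
Proof.
rewrite /variation /cells (big_nth (0, 0)) size_pairmap big_nat_cond.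
rewrite [RHS]big_nat_cond; apply: eq_bigr => i; rewrite andbT => /andP[_ i_s].
rewrite (nth_pairmap b)//= (set_nth_default a b)//.
Qed.

Lemma cells_subset (R : realType) (a : R) (s : seq R) (p : R * R) :
  path <%O a s -> p \in cells a s ->
  [&& a <= p.1, p.1 <= p.2 & p.2 <= last a s].
Proof.
elim: s a => //= x s ih a /andP[ax xs]; rewrite inE => /predU1P[->/=|/(ih _ xs)].
  by rewrite lexx ltW//= unstable.path_lt_le_last.
by move=> /and3P[xp -> ->]; rewrite (le_trans (ltW ax) xp).
Qed.

Lemma cells_nonoverlapping (R : realType) (a : R) (s : seq R) :
  path <%O a s -> pairwise (@nonoverlapping R) (cells a s).
Proof.
elim: s a => //= x s ih a /andP[ax xs]; rewrite ih// andbT.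
apply/allP => p /(cells_subset xs) /and3P[xp _ _].
by rewrite /nonoverlapping/= xp.
Qed.

Lemma subintervals_cat (R : realType) (a b : R) (s t : seq (R * R)) :
  subintervals a b (s ++ t) =
  [&& subintervals a b s, subintervals a b t & allrel (@nonoverlapping R) s t].
Proof.
rewrite /subintervals all_cat pairwise_cat; case: allrel; rewrite !(andbT, andbF)//=.
  by case: all; rewrite //= ?andbF// andbCA.
Qed.

(** Induction on [t]: the total variation over its head is a supremum over partitions, and trading
    the head for the cells of a partition moves them to [s] without changing the total length. The
    case of empty [s] is the one used later. *)
Lemma absolutely_continuous_sum_total_variation (R : realType) (a b e d : R)
    (f : R -> R) :
  (forall s, subintervals a b s ->
    \sum_(p <- s) (p.2 - p.1) < d -> \sum_(p <- s) `|f p.2 - f p.1| < e) ->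
  forall s t, subintervals a b (s ++ t) -> \sum_(p <- s ++ t) (p.2 - p.1) < d ->
  ((\sum_(p <- s) `|f p.2 - f p.1|)%:E +
     \sum_(p <- t) total_variation p.1 p.2 f <= e%:E)%E.
Proof.
move=> h s t; elim: t s => [s|p t ih s].
  by rewrite cats0 big_nil adde0 lee_fin => sab sd; apply/ltW/h.
move=> sab sd; rewrite big_cons.
have /and3P[ss /andP[/= /andP[/and3P[ap p12 pb] tb] /andP[pt tt]] st] :
  [&& subintervals a b s, subintervals a b (p :: t)
    & allrel (@nonoverlapping R) s (p :: t)] by rewrite -subintervals_cat.
move: st; rewrite allrel_consr => /andP[sp st].
have sab' : subintervals a b (s ++ t).
  by rewrite subintervals_cat ss st /subintervals tb tt.
have sd' : \sum_(q <- s ++ t) (q.2 - q.1) < d.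
  apply: le_lt_trans sd; rewrite !big_cat/= big_cons lerD2l lerDr subr_ge0//.
move: p12; rewrite le_eqVlt => /predU1P[p12|p12].
  by rewrite p12 total_variationxx add0e; exact: ih.
have fin : ((\sum_(q <- s) `|f q.2 - f q.1|)%:E +
    \sum_(q <- t) total_variation q.1 q.2 f)%E \is a fin_num.
  have h0 := ih _ sab' sd'.
  have hs0 : (0 <= \sum_(p <- t) total_variation p.1 p.2 f)%E.
    rewrite big_seq; apply: sume_ge0 => q qt; apply: total_variation_ge0.
    by have /andP[_] := allP tb q qt; case/andP.
  rewrite fin_numD/= ge0_fin_numE//.
  apply: le_lt_trans (ltry e); apply: le_trans h0.
  by rewrite leeDr// lee_fin sumr_ge0.
(* The finite remainder goes to the right, so that the supremum defining the total variation over
   [p] can be bounded one partition at a time. *)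
rewrite addeCA -leeBrDr//.
apply: ge_ereal_sup => _ [_ [c [cp cl] <-] <-].
rewrite leeBrDr//.
rewrite -(cells_variation p.1 p.2) addeA -EFinD -big_cat; apply: ih.
  rewrite -catA !subintervals_cat ss st allrel_catr.
  have cpq q : q \in cells p.1 c -> [&& p.1 <= q.1, q.1 <= q.2 & q.2 <= p.2].
    by move=> /(cells_subset cp); rewrite (eqP cl).
  rewrite /subintervals tb tt cells_nonoverlapping//= !andbT.
  apply/and3P; split.
  - apply/allP => q /cpq /and3P[pq -> qp].
    by rewrite (le_trans ap pq) (le_trans qp pb).
  - apply/allrelP => q r /cpq /and3P[pq _ qp] rs.
    have /orP[h'|h'] := allP sp r rs; apply/orP; [right|left].
      exact: le_trans pq.
    exact: le_trans h'.
  - apply/allrelP => q r /cpq /and3P[pq _ qp] rt.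
    have /orP[h'|h'] := allP pt r rt; apply/orP; [left|right].
      exact: le_trans h'.
    exact: le_trans pq.
rewrite !big_cat/= cells_sum_length (eqP cl).
by move: sd; rewrite big_cat/= big_cons; lra.
Qed.

Lemma subintervals_of_trivIset (R : realType) (a b : R) (n : nat)
    (l u : 'I_n -> R) :
  (forall i, [&& a <= l i, l i <= u i & u i <= b]) ->
  trivIset setT (fun i => `]l i, u i[%classic) ->
  subintervals a b [seq (l i, u i) | i <- enum 'I_n & l i < u i].
Proof.
move=> lu /trivIsetP tlu; apply/andP; split.
  by apply/allP => _ /mapP[i _ ->]; exact: lu.
rewrite pairwise_map.
apply: (@sub_in_pairwise _ [pred i | l i < u i] (fun i j => i != j)).
- move=> i j; rewrite !inE => lui luj ij; rewrite /nonoverlapping/= !leNgt -negb_and.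
  apply/negP => /andP[lj li].
  (* The midpoint of the overlap would lie in both open intervals. *)
  pose m := (Num.max (l i) (l j) + Num.min (u i) (u j)) / 2.
  have : Num.max (l i) (l j) < Num.min (u i) (u j).
    by rewrite gt_max !lt_min lui luj li lj.
  move=> mm; have := tlu i j I I ij; rewrite -subset0 => /(_ m); apply.
  have h1 : Num.max (l i) (l j) < m by rewrite /m; lra.
  have h2 : m < Num.min (u i) (u j) by rewrite /m; lra.
  move: h1 h2; rewrite gt_max lt_min => /andP[? ?] /andP[? ?].
  by split; rewrite /= in_itv/=; apply/andP.
- by apply/allP => i; rewrite mem_filter inE => /andP[].
- by rewrite -uniq_pairwise filter_uniq// enum_uniq.
Qed.

Lemma sum_nondegenerate (R : realType) (n : nat) (l u : 'I_n -> R)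
    (F : R * R -> R) :
  (forall i, l i <= u i) -> (forall x, F (x, x) = 0) ->
  \sum_(i < n) F (l i, u i) =
  \sum_(p <- [seq (l i, u i) | i <- enum 'I_n & l i < u i]) F p.
Proof.
move=> lu F0; rewrite big_map big_filter big_enum_cond/=.
rewrite (bigID (fun i => l i < u i))/= [X in _ + X]big1 ?addr0//.
move=> i; rewrite -leNgt => ul.
by have -> : u i = l i; [apply/le_anti; rewrite lu ul|].
Qed.

(** For the bound 1, an interval shorter than the resulting [d] has total variation at most 1, and
    finitely many steps of length d / 2 cover [a, b]. *)
Lemma absolutely_continuous_bounded_variation (R : realType) (a b : R)
    (f : R -> R) : a <= b ->
  absolutely_continuous_on a b f -> bounded_variation a b f.
Proof.
move=> ab acf; have [d d0 h] := absolutely_continuous_seq acf ltr01.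
have TV1 := absolutely_continuous_sum_total_variation h.
have small x y : a <= x -> x <= y -> y <= b -> y - x < d ->
    (total_variation x y f <= 1%:E)%E.
  move=> ax xy yb xyd; have := TV1 [::] [:: (x, y)].
  rewrite !big_nil !big_seq1/= add0e; apply => //.
  by rewrite /subintervals/= ax xy yb.
pose h' := d / 2.
have h'0 : 0 < h' by rewrite divr_gt0.
have steps n x : a <= x -> x <= b -> x <= a + h' *+ n ->
    (total_variation a x f <= n%:R%:E)%E.
  elim: n x => [x ax xb|n ih x ax xb xn].
    rewrite mulr0n addr0 => xa; have -> : x = a by apply/le_anti; rewrite xa ax.
    by rewrite total_variationxx.
  pose y := Num.max a (x - h').
  have ay : a <= y by rewrite le_max lexx.
  have yx : y <= x by rewrite ge_max ax gerBl ltW.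
  rewrite (total_variationD f ay yx) -addn1 natrD EFinD; apply: leeD.
    apply: ih => //; first exact: le_trans xb.
    rewrite ge_max; apply/andP; split.
      by rewrite lerDl mulrn_wge0// ltW.
    by move: xn; rewrite mulrS; lra.
  apply: small => //.
  have : x - h' <= y by rewrite le_max lexx orbT.
  by move: d0; rewrite /h'; lra.
apply/bounded_variationP => //.
rewrite ge0_fin_numE ?total_variation_ge0//.
have [n bn] : exists n, b <= a + h' *+ n.
  exists (Num.truncn ((b - a) / h')).+1.
  rewrite -lerBlDl -mulr_natl -ler_pdivrMr//.
  exact/ltW/truncnS_gt.
exact: le_lt_trans (steps n b ab (lexx _) bn) (ltry _).
Qed.

(** Needed for the Jordan decomposition, whose two nondecreasing terms must themselves be absolutely
    continuous. *)
Lemma absolutely_continuous_total_variation (R : realType) (a b : R)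
    (f : R -> R) : a <= b -> absolutely_continuous_on a b f ->
  absolutely_continuous_on a b (fun x => fine (total_variation a x f)).
Proof.
move=> ab acf; have bvf := absolutely_continuous_bounded_variation ab acf.
(* The bound on sums of total variations is a weak inequality; half of [e] restores a strict one. *)
move=> e e0; have e20 : 0 < e / 2 by rewrite divr_gt0.
have [d d0 h] := absolutely_continuous_seq acf e20.
exists d => // n l u lu tlu sd.
have lui i : l i <= u i by case/and3P: (lu i).
have sub := subintervals_of_trivIset lu tlu.
rewrite (@sum_nondegenerate _ _ l u (fun p => p.2 - p.1)) in sd => //; last first.
  by move=> x; rewrite subrr.
rewrite (@sum_nondegenerate _ _ l u (fun p => `|fine (total_variation a p.2 f) - fine (total_variation a p.1 f)|))//; last first.
  by move=> x; rewrite subrr normr0.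
apply: (@le_lt_trans _ _ (e / 2)); last by move: e0; lra.
have := absolutely_continuous_sum_total_variation h (s := [::]) sub sd.
rewrite big_nil add0e -lee_fin; apply: le_trans.
rewrite -sumEFin big_seq [leRHS]big_seq; apply: lee_sum => p.
move=> /(allP (andP sub).1) /and3P[ap p12 pb].
have fin x : a <= x -> x <= b -> total_variation a x f \is a fin_num.
  by move=> ax xb; apply/bounded_variationP => //; exact: bounded_variationl bvf.
have p1b := le_trans p12 pb; have ap2 := le_trans ap p12.
have TVE := total_variationD f ap p12.
have TVfin : total_variation p.1 p.2 f \is a fin_num.
  rewrite ge0_fin_numE ?total_variation_ge0//.
  have := fin _ ap2 pb; rewrite ge0_fin_numE ?total_variation_ge0//.
  by apply: le_lt_trans; rewrite TVE leeDr// total_variation_ge0.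
rewrite TVE fineD ?fin// addrAC subrr add0r ger0_norm ?fineK//.
by rewrite fine_ge0// total_variation_ge0.
Qed.

(** Composing with this projection extends a function from [a, b] to the whole line, constant on
    either side. When b < a its value is a. *)
Definition clamp (R : realType) (a b x : R) : R := Num.max a (Num.min b x).

Lemma clamp_in (R : realType) (a b x : R) : a <= b -> a <= clamp a b x <= b.
Proof. by move=> ab; rewrite /clamp le_max lexx/= ge_max ab ge_min lexx. Qed.

Lemma clamp_id (R : realType) (a b x : R) : a <= x <= b -> clamp a b x = x.
Proof.
move=> /andP[ax xb]; rewrite /clamp (min_idPr xb); exact/max_idPr.
Qed.

Lemma clamp_nondecreasing (R : realType) (a b : R) :
  {homo clamp a b : x y / x <= y}.
Proof.
move=> x y xy; rewrite /clamp ge_max le_max lexx/= le_max.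
apply/orP; right; rewrite le_min !ge_min lexx/=; apply/orP; right; exact: xy.
Qed.

Lemma clamp_sub (R : realType) (a b x y : R) : x <= y ->
  clamp a b y - clamp a b x <= y - x.
Proof.
move=> xy; rewrite /clamp /Order.max /Order.min.
by case: (ltrP b x) => ?; case: (ltrP b y) => ?; case: ltrP => ?; case: ltrP => ?; lra.
Qed.

Lemma clamp_lipschitz (R : realType) (a b x y : R) :
  `|clamp a b y - clamp a b x| <= `|y - x|.
Proof.
wlog xy : x y / x <= y => [wl|].
  by have [/wl//|/ltW/wl] := leP x y; rewrite distrC (distrC x).
by rewrite !ger0_norm ?subr_ge0 ?clamp_sub// clamp_nondecreasing.
Qed.

Lemma continuous_clamp (R : realType) (a b : R) : continuous (@clamp R a b).
Proof.
move=> x; apply/cvgrPdist_lt => e e0; near=> y.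
rewrite distrC; apply: le_lt_trans (clamp_lipschitz _ _ _ _) _.
by near: y; exists e => //= z; rewrite /= distrC.
Unshelve. all: by end_near. Qed.

(** A point strictly between two clamped endpoints lies in ]a, b[, where clamping changes nothing,
    so it already lay between the original ones; when b < a the clamped intervals are empty. *)
Lemma clamp_trivIset (R : realType) (a b : R) (n : nat) (l u : 'I_n -> R) :
  trivIset setT (fun i => `]l i, u i[%classic) ->
  trivIset setT (fun i => `]clamp a b (l i), clamp a b (u i)[%classic).
Proof.
move=> /trivIsetP tlu; apply/trivIsetP => i j _ _ ij.
rewrite -subset0 => x [/=]; rewrite !in_itv/= => /andP[li ui] /andP[lj uj].
have := tlu i j I I ij; rewrite -subset0 => /(_ x); apply.
have lc y : clamp a b y < x -> x < b -> y < x.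
  rewrite /clamp gt_max gt_min => /andP[_ /orP[bx xb|//]].
  by have := lt_trans bx xb; rewrite ltxx.
have gc y : x < clamp a b y -> a < x -> x < y.
  rewrite /clamp lt_max lt_min => /orP[ax xa|/andP[]//].
  by have := lt_trans ax xa; rewrite ltxx.
have xb : x < b \/ b < a.
  have [ab|] := leP a b; last by right.
  by left; apply: lt_le_trans ui _; case/andP: (clamp_in (u i) ab).
have ax : a < x by apply: le_lt_trans li; rewrite /clamp le_max lexx.
case: xb => [xb|ba]; last first.
  have cE y : clamp a b y = a.
    by rewrite /clamp; apply/max_idPl; rewrite ge_min (ltW ba).
  by move: li ui; rewrite !cE => h1 h2; have := lt_trans h1 h2; rewrite ltxx.
by split; rewrite /= in_itv/=; apply/andP; split; auto.
Qed.


(** * Densities and derivatives of absolutely continuous functions *)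

Lemma open_interval_bounded (R : realType) (A : set R) :
  open A -> is_interval A -> has_lbound A -> has_ubound A ->
  inf A <= sup A /\ A = `]inf A, sup A[%classic.
Proof.
move=> oA iA lA uA; split.
  have [->|/set0P[x Ax]] := eqVneq A set0; first by rewrite inf0 sup0.
  by apply: (@le_trans _ _ x); [exact: ge_inf|exact: ub_le_sup].
have /interior_id {1}<- := oA; rewrite interval_bounded_interior//.
Qed.

Lemma lebesgue_stieltjes_measure_oc (R : realType) (F : cumulative R R)
    (l u : R) : l <= u ->
  lebesgue_stieltjes_measure F `]l, u]%classic = (F u - F l)%:E.
Proof.
move=> lu; rewrite /lebesgue_stieltjes_measure /measure_extension.
rewrite measurable_mu_extE/=; last exact: is_ocitv.
by rewrite wlength_itv_bnd.
Qed.

(** A null set has an open cover of measure less than [d]. Its components are disjoint intervals,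
    and the increments of [F] over any finitely many of them sum to less than [e]; countable
    additivity does the rest. *)
Lemma absolutely_continuous_dominated (R : realType) (a b : R) (f : R -> R)
    (F : cumulative R R) :
  a <= b -> absolutely_continuous_on a b f -> (F : R -> R) = f \o clamp a b ->
  forall A : set (measurableTypeR R), measurable A -> A `<=` `]a, b] ->
  @lebesgue_measure R A = 0%E -> lebesgue_stieltjes_measure F A = 0%E.
Proof.
move=> ab acf FE A mA Aab A0; pose nu : {measure set (measurableTypeR R) -> \bar R} := lebesgue_stieltjes_measure F.
pose mu : {measure set (measurableTypeR R) -> \bar R} := @lebesgue_measure R.
change (nu A = 0%E); apply/eqP; rewrite -measure_le0; apply/lee_addgt0Pr => e e0; rewrite add0e.
have [d d0 h] := acf e e0.
have [U [oU AU UAd]] : exists U : set R,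
    [/\ open U, A `<=` U & (mu (U `\` A) < d%:E)%E].
  apply: lebesgue_regularity_outer => //; apply: (@le_lt_trans _ _ 0%E) => //.
  by rewrite le_eqVlt; apply/orP; left; apply/eqP; exact: A0.
(* Cutting down to a bounded window makes every component an interval between its infimum and its
   supremum. *)
pose V := U `&` `]a - 1, b + 1[%classic.
have oV : open V by apply: openI => //; exact: interval_open.
have AV : A `<=` V.
  move=> x Ax; split; first exact: AU.
  by have := Aab x Ax; rewrite /= !in_itv/= => /andP[? ?]; apply/andP; split; lra.
have mV : measurable V by exact: open_measurable.
have Vd : (mu V < d%:E)%E.
  have : (mu V <= mu (U `\` A) + mu A)%E.
    apply: le_trans (measureU2 _ _ _) => //; last first.
      by apply: measurableD => //; exact: open_measurable.
    rewrite le_measure ?inE//.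
      by apply: measurableU => //; apply: measurableD => //; exact: open_measurable.
    by move=> x [Ux _]; have [Ax|nAx] := pselect (A x); [right|left].
  by rewrite [X in (_ + X)%E](_ : _ = 0%E) ?adde0//; move=> /le_lt_trans; apply.
pose I := open_disjoint_itv oV.
have VE : V = \bigcup_k I k := open_disjoint_itv_bigcup oV.
have IV k : I k `<=` V by rewrite VE; exact: bigcup_sup.
have Iin k : inf (I k) <= sup (I k) /\ I k = `]inf (I k), sup (I k)[%classic.
  apply: open_interval_bounded.
  - exact: open_disjoint_itv_open.
  - exact: open_disjoint_itv_is_interval.
  - exists (a - 1) => x /IV[_]; rewrite /= in_itv/= => /andP[/ltW//].
  - exists (b + 1) => x /IV[_]; rewrite /= in_itv/= => /andP[_ /ltW//].
have mI k : measurable (I k) by apply: open_measurable; exact: open_disjoint_itv_open.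
have tI : trivIset setT I by exact: open_disjoint_itv_trivIset.
have sumI (m : {measure set (measurableTypeR R) -> \bar R}) :
    m V = (\sum_(0 <= k <oo) m (I k))%E.
  rewrite [in LHS]VE measure_bigcup//; last by move=> k _; exact: mI.
  by apply: eq_eseriesl => k; rewrite in_setT.
apply: (@le_trans _ _ (nu V)); first by rewrite le_measure ?inE.
rewrite (sumI nu); apply: lime_le; first exact: is_cvg_nneseries.
apply: nearW => n; rewrite big_mkord.
pose l (k : 'I_n) := inf (I k); pose u (k : 'I_n) := sup (I k).
have lu k : l k <= u k by case: (Iin k).
(* Each open component is enlarged to a half-open interval, whose Stieltjes measure is the increment
   of [F]. *)
apply: (@le_trans _ _ (\sum_(k < n) (F (u k) - F (l k))%:E)%E).
  apply: lee_sum => k _; rewrite -lebesgue_stieltjes_measure_oc//.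
  rewrite le_measure ?inE//; first exact: mI.
  by rewrite (Iin k).2; exact: subset_itv_oo_oc.
rewrite sumEFin lee_fin; apply: ltW.
apply: le_lt_trans (h n (clamp a b \o l) (clamp a b \o u) _ _ _).
- by apply: ler_sum => k _; rewrite FE/=; exact: ler_norm.
- move=> i /=; have /andP[-> _] := clamp_in (l i) ab.
  by have /andP[_ ->] := clamp_in (u i) ab; rewrite clamp_nondecreasing.
- apply: clamp_trivIset; rewrite (_ : (fun _ => _) = fun i : 'I_n => I i); last first.
    by apply/funext => i; rewrite [RHS](Iin i).2.
  move/trivIsetP : tI => tI; apply/trivIsetP => i j _ _ ij.
  by apply: tI => //; apply: contra_neq ij => /ord_inj.
- apply: (@le_lt_trans _ _ (\sum_(k < n) (u k - l k))).
    by apply: ler_sum => k _; exact: clamp_sub.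
  rewrite -lte_fin; apply: le_lt_trans Vd; rewrite -sumEFin.
  rewrite (sumI mu); apply: le_trans (nneseries_lim_ge n _) => //.
  rewrite big_mkord; apply: lee_sum => k _.
  change ((u k - l k)%:E <= @lebesgue_measure R (I k))%E.
  rewrite (Iin k).2 lebesgue_measure_itv/=.
  rewrite lte_fin; case: ltP; rewrite -/(l k) -/(u k) => //.
  by move=> ul; have -> : u k = l k; [apply/le_anti; rewrite ul lu|rewrite subrr].
Qed.

(** Clamping makes f a cumulative function on the line. Its Stieltjes measure restricted to ]a, b]
    is finite and dominated by Lebesgue measure, so Radon-Nikodym provides the density. *)
Lemma nondecreasing_absolutely_continuous_density (R : realType) (a b : R)
    (f : R -> R) : a <= b -> absolutely_continuous_on a b f ->
  (forall x y, a <= x -> x <= y -> y <= b -> f x <= f y) ->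
  exists g : R -> R,
    (@lebesgue_measure R).-integrable setT (EFin \o g) /\
    forall x, a <= x <= b ->
      f x = f a + \int[@lebesgue_measure R]_(t in `[a, x]) g t.
Proof.
move=> ab acf ndf; pose F := f \o clamp a b.
have ndF : nondecreasing F.
  move=> x y xy /=.
  have /andP[? ?] := clamp_in x ab; have /andP[? ?] := clamp_in y ab.
  by apply: ndf => //; exact: clamp_nondecreasing.
have rcF : right_continuous F.
  apply: right_continuousW => x; apply/cvgrPdist_lt => e e0.
  have [d d0 h] := absolutely_continuous_uniform acf e0.
  near=> y; apply: h; rewrite ?clamp_in//.
  apply: le_lt_trans (clamp_lipschitz _ _ _ _) _.
  by near: y; exists d.
pose Fc : cumulative R R := HB.pack F (isCumulative.Build R _ R F ndF rcF).
pose D := `]a, b]%classic : set (measurableTypeR R).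
have mD : measurable D by exact: measurable_itv.
have FD : (lebesgue_stieltjes_measure Fc D < +oo)%E.
  by rewrite lebesgue_stieltjes_measure_oc// ltry.
pose nu : {finite_measure set (measurableTypeR R) -> \bar R} := mfrestr mD FD.
have dom : nu `<< @lebesgue_measure R.
  apply/null_content_dominatesP => A mA A0.
  apply: (absolutely_continuous_dominated ab acf (F := Fc)) => //.
  - exact: measurableI.
  - apply/eqP; rewrite -measure_le0 -A0 le_measure ?inE//.
    exact: measurableI.
have [h [h0 hfin hint nuE]] := radon_nikodym_sigma_finite dom.
have ih : (@lebesgue_measure R).-integrable setT (EFin \o (fine \o h)).
  by apply: eq_integrable hint => // x _; rewrite /= fineK.
exists (fine \o h); split => //.
move=> x /andP[ax xb].
have : nu `]a, x]%classic = (f x - f a)%:E.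
  rewrite /nu /= /mfrestr /mrestr setIidl; last first.
    by move=> y; rewrite /D/= !in_itv/= => /andP[-> /le_trans]; exact.
  rewrite lebesgue_stieltjes_measure_oc//= /F/= !clamp_id ?ax//.
  by rewrite lexx ab.
have mx : measurable (`]a, x]%classic : set (measurableTypeR R)).
  exact: measurable_itv.
rewrite (nuE _ mx).
move=> E; suff -> : \int[@lebesgue_measure R]_(t in `[a, x]) (fine \o h) t = f x - f a.
  by rewrite addrC subrK.
rewrite -Rintegral_itv_obnd_cbnd; last first.
  exact: integrableS ih.
rewrite /Rintegral -[RHS]/(fine (f x - f a)%:E) -E; congr fine.
by apply: eq_integral => y _; rewrite /= fineK.
Unshelve. all: by end_near. Qed.

Lemma absolutely_continuous_onB (R : realType) (a b : R) (f g : R -> R) :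
  absolutely_continuous_on a b f -> absolutely_continuous_on a b g ->
  absolutely_continuous_on a b (fun x => f x - g x).
Proof.
move=> acf acg e e0; have e20 : 0 < e / 2 by rewrite divr_gt0.
have [d1 d10 h1] := acf _ e20; have [d2 d20 h2] := acg _ e20.
exists (Num.min d1 d2); first by rewrite lt_min d10.
move=> n l u lu tlu; rewrite lt_min => /andP[s1 s2].
have := ltrD (h1 n l u lu tlu s1) (h2 n l u lu tlu s2).
rewrite -splitr; apply: le_lt_trans; rewrite -big_split/=; apply: ler_sum => i _.
rewrite (_ : _ - _ = f (u i) - f (l i) - (g (u i) - g (l i))); last by ring.
exact: ler_normB.
Qed.

(** Jordan decomposition: V and V - f are nondecreasing and absolutely continuous, and g is the
    difference of their densities. Lebesgue differentiation of its integral gives the derivative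
    almost everywhere. *)
Lemma absolutely_continuous_FTC (R : realType) (a b : R) (f : R -> R) :
  a <= b -> absolutely_continuous_on a b f ->
  exists g : R -> R,
    [/\ (@lebesgue_measure R).-integrable setT (EFin \o g),
        forall x, a <= x <= b ->
          f x = f a + \int[@lebesgue_measure R]_(t in `[a, x]) g t &
        {ae @lebesgue_measure R, forall x, a < x < b -> is_derive x 1 f (g x)}].
Proof.
move=> ab acf; pose V x := fine (total_variation a x f).
have acV : absolutely_continuous_on a b V.
  exact: absolutely_continuous_total_variation.
have bvf := absolutely_continuous_bounded_variation ab acf.
have fin x : a <= x -> x <= b -> total_variation a x f \is a fin_num.
  by move=> ax xb; apply/bounded_variationP => //; exact: bounded_variationl bvf.
have VB x y : a <= x -> x <= y -> y <= b -> `|f y - f x| <= V y - V x.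
  move=> ax xy yb; rewrite -lee_fin.
  apply: (le_trans (total_variation_ge f xy)).
  have ay := le_trans ax xy; have xb := le_trans xy yb.
  rewrite EFinB /V !fineK ?fin// leeBrDr ?fin//.
  by rewrite addeC (total_variationD f ax xy).
have ndV x y : a <= x -> x <= y -> y <= b -> V x <= V y.
  by move=> ax xy yb; rewrite -subr_ge0; apply: le_trans (VB _ _ ax xy yb).
have acW : absolutely_continuous_on a b (fun x => V x - f x).
  exact: absolutely_continuous_onB.
have ndW x y : a <= x -> x <= y -> y <= b -> V x - f x <= V y - f y.
  move=> ax xy yb; have := le_trans (ler_norm _) (VB _ _ ax xy yb); lra.
have [g1 [ig1 E1]] := nondecreasing_absolutely_continuous_density ab acV ndV.
have [g2 [ig2 E2]] := nondecreasing_absolutely_continuous_density ab acW ndW.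
pose g x := g1 x - g2 x.
have ig : (@lebesgue_measure R).-integrable setT (EFin \o g).
  by apply: eq_integrable (integrableB measurableT ig1 ig2).
have fE x : a <= x <= b -> f x = f a + \int[@lebesgue_measure R]_(t in `[a, x]) g t.
  move=> xab; rewrite RintegralB//=; first by have := E1 x xab; have := E2 x xab; lra.
    exact: integrableS ig1.
  exact: integrableS ig2.
exists g; split => //.
have lg : locally_integrable setT g by apply: open_integrable_locally => //; exact: openT.
have igy (y : R) : (@lebesgue_measure R).-integrable [set` `[a, y]] (EFin \o g).
  by apply: integrableS ig.
have := FTC1 igy lg.
apply: filterS; first exact: (ae_filter_ringOfSetsType (@lebesgue_measure R)).
move=> x h /andP[ax xb].
have [|dG G'E] := h; first by rewrite lte_fin.
pose G y := \int[@lebesgue_measure R]_(t in `[a, y]) g t.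
have dG' : is_derive x 1 G (g x) by apply: DeriveDef => //; rewrite -derive1E.
have := is_deriveD (is_derive_cst (f a) x 1) dG'; rewrite add0r.
apply: near_eq_is_derive; near=> y; rewrite [RHS]fE//.
apply/andP; split; apply: ltW; near: y; first exact: lt_nbhsr.
exact: lt_nbhsl.
Unshelve. all: by end_near. Qed.

(** * Optimal plans *)

(** The integral of a nonnegative function is a supremum over the simple functions below it, and
    those below [f] on D are below [g]. *)
Lemma ge0_le_integral_majorant d (X : measurableType d) (R : realType)
    (mu : {measure set X -> \bar R}) (D : set X) (f g : X -> \bar R) :
  (forall x, D x -> (0 <= f x)%E) -> (forall x, D x -> (f x <= g x)%E) ->
  (\int[mu]_(x in D) f x <= \int[mu]_(x in D) g x)%E.
Proof.
move=> f0 fg; rewrite !ge0_integralE//; last by move=> x Dx; apply: le_trans (fg _ Dx); exact: f0.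
apply: ge_ereal_sup => _ [h hf <-]; apply: ereal_sup_ubound; exists h => // x.
apply: (le_trans (hf x)); rewrite !patchE; case: ifPn => //.
by rewrite inE; exact: fg.
Qed.

(* No measurability is required of the majorant g: it will be an integrand
   involving [derive1 y], which takes junk values where y is not derivable. *)
Lemma ae_ge0_le_integral_majorant d (X : measurableType d) (R : realType)
    (mu : {measure set X -> \bar R}) (D : set X) (f g : X -> \bar R) :
  measurable D -> measurable_fun D f ->
  (forall x, D x -> (0 <= f x)%E) -> (forall x, D x -> (0 <= g x)%E) ->
  {ae mu, forall x, D x -> (f x <= g x)%E} ->
  (\int[mu]_(x in D) f x <= \int[mu]_(x in D) g x)%E.
Proof.
move=> mD mf f0 g0 [N [mN N0 fgN]].
rewrite (ge0_negligible_integral mN)// setDE integral_mkcondr.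
apply: ge0_le_integral_majorant => x Dx; rewrite patchE; case: ifPn => //.
- by move=> _; exact: f0.
- rewrite inE => Nx; apply: contrapT => fgx; apply: Nx; apply: fgN => /=.
  by move=> h; apply: fgx; exact: h.
- by move=> _; exact: g0.
Qed.

(** * Derivatives within an interval *)

Lemma has_derivative_within_continuous (R : realType) (A : set R) (f : R -> R)
    (s l : R) :
  has_derivative_within A f s l -> f u @[u --> within A (nbhs s)] --> f s.
Proof.
move=> fsl; have h : (f u - f s) / (u - s) * (u - s) @[u --> within A s^'] --> l * (s - s).
  apply: cvgM => //; apply: cvgB; last exact: cvg_cst.
  by apply: cvg_within_filter; apply: cvg_within_filter; exact: cvg_id.
rewrite subrr mulr0 in h.
apply/cvgrPdist_lt => e e0; move/cvgrPdist_lt : h => /(_ e e0).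
rewrite !near_withinE; apply: filterS => u /[swap] Au.
have [->|us /(_ isT Au)] := eqVneq u s; first by rewrite subrr normr0.
by rewrite sub0r normrN divfK ?subr_eq0// distrC.
Qed.

Lemma is_derive1P (R : realType) (f : R -> R) (s l : R) :
  is_derive s 1 f l <-> (f u - f s) / (u - s) @[u --> s^'] --> l.
Proof.
have E : (fun h => h^-1 *: ((f \o shift s) (h *: 1) - f s)) @ 0^' =
    (f u - f s) / (u - s) @[u --> s^'].
  rewrite predeqE => A.
  change ((\forall h \near 0^', A (h^-1 *: ((f \o shift s) (h *: 1) - f s))) <->
    \forall u \near s^', A ((f u - f s) / (u - s))).
  rewrite !near_withinE.
  have E := near_shift (0 : R) s (fun u => u != s -> A ((f u - f s) / (u - s))).
  have [E1 E2] : (\forall u \near s, u != s -> A ((f u - f s) / (u - s))) <->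
      \forall h \near (0 : R), h + s != s -> A ((f (h + s) - f s) / (h + s - s)).
    by rewrite E /= subr0.
  split => [h|/E1 h]; [apply: E2|]; move: h; apply: filterS => h /= + hs.
    have h0 : h != 0 by apply: contra_neq hs => ->; rewrite add0r.
    by move=> /(_ h0); rewrite addrK /GRing.scale/= mulr1 mulrC.
  have : h + s != s by rewrite -subr_eq0 addrK.
  by move=> h0 /(_ h0); rewrite addrK /GRing.scale/= mulr1 mulrC.
split => [[df <-]|fl].
  by rewrite -E; exact: df.
have fl' : (fun h => h^-1 *: ((f \o shift s) (h *: 1) - f s)) @ 0^' --> l by rewrite E.
by apply: DeriveDef; [apply/cvg_ex; exists l|exact: cvg_lim fl'].
Qed.

Lemma has_derivative_within_interior (R : realType) (a b : R) (f : R -> R)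
    (s l : R) : a < s < b ->
  has_derivative_within `[a, b] f s l -> is_derive s 1 f l.
Proof.
move=> /andP[as_ sb] fl; apply/is_derive1P; apply: cvg_trans fl.
apply: cvg_app => P h; have : \forall u \near s^', `[a, b]%classic u.
  apply: cvg_within; near=> u; rewrite /= in_itv/=.
  by apply/andP; split; apply: ltW; near: u; [exact: lt_nbhsr|exact: lt_nbhsl].
move=> h'; have {}h : \forall u \near s^', `[a, b]%classic u -> P u by exact: h.
by apply: filterS2 h h' => u; exact.
Unshelve. all: by end_near. Qed.

Lemma has_derivative_within_at_right (R : realType) (a b : R) (f : R -> R)
    (l : R) : a < b ->
  has_derivative_within `[a, b] f a l -> initial_derivative a f l.
Proof.
move=> ab; apply: cvg_trans; apply: cvg_app => P; rewrite /within/= => h.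
near=> u; have au : a < u by near: u; exact: nbhs_right_gt.
have ub : u < b by near: u; exact: nbhs_right_lt.
have : u != a -> `[a, b]%classic u -> P u.
  near: u; apply: cvg_within; exact: h.
apply; first by rewrite gt_eqF.
by rewrite /= in_itv/= !ltW.
Unshelve. all: by end_near. Qed.

Lemma has_derivative_within_integral (R : realType) (a b c d : R)
    (f F : R -> R) : a <= c -> c <= d -> d <= b ->
  {within `[a, b], continuous f} ->
  (forall s, a <= s -> s <= b -> has_derivative_within `[a, b] F s (f s)) ->
  (\int[@lebesgue_measure R]_(s in `[c, d]) (f s)%:E = (F d - F c)%:E)%E.
Proof.
move=> ac + db cf dF; rewrite le_eqVlt => /predU1P[<-|cd].
  by rewrite set_itv1 integral_set1 subrr.
have sub : `[c, d] `<=` `[a, b].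
  by move=> x /=; rewrite !in_itv/= => /andP[? ?]; rewrite (le_trans ac)//= (le_trans _ db).
have dF' s : c < s < d -> is_derive s 1 F (f s).
  move=> /andP[cs sd]; apply: (@has_derivative_within_interior _ a b).
    by rewrite (le_lt_trans ac)//= (lt_le_trans sd).
  by apply: dF; apply: ltW; [exact: le_lt_trans cs|exact: lt_le_trans db].
have cF : {within `[c, d], continuous F}.
  apply: (continuous_subspaceW sub); apply/subspace_continuousP => x.
  rewrite /= in_itv/= => /andP[ax xb].
  exact: has_derivative_within_continuous (dF _ ax xb).
rewrite EFinB; apply: continuous_FTC2 => //.
- exact: continuous_subspaceW cf.
- have [_ ? ?] := (continuous_within_itvP _ cd).1 cF; split => // x.
  by rewrite in_itv/= => /dF' [].
- by move=> x; rewrite in_itv/= => /dF' [_ <-]; rewrite derive1E.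
Qed.

(** Convexity of the power function. The equality case is kept because a plan that runs ahead must
    be strictly more expensive. *)
Lemma powR_tangent (R : realType) (alpha c x : R) : 1 < alpha -> 0 <= c ->
  0 <= x ->
  alpha * c `^ (alpha - 1) * x <= x `^ alpha + (alpha - 1) * c `^ alpha
    ?= iff (x == c).
Proof.
move=> a1; have a0 : 0 < alpha by apply: lt_trans a1.
have am0 : 0 < alpha - 1 by rewrite subr_gt0.
rewrite le_eqVlt => /predU1P[<-|c0].
  rewrite (powR0 (lt0r_neq0 am0)) (powR0 (lt0r_neq0 a0)) !(mulr0, mul0r) addr0 => x0; apply/leifP.
  have [->|xn0] := eqVneq x 0; first by rewrite powR0 ?eqxx// gt_eqF.
  by rewrite powR_gt0// lt_neqAle eq_sym xn0.
rewrite le_eqVlt => /predU1P[<-|x0].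
  rewrite mulr0 (powR0 (lt0r_neq0 a0)) add0r; apply/leifP.
  by rewrite lt_eqF// mulr_gt0// powR_gt0.
have cE : c = expR (ln c) by rewrite lnK.
have xE : x = expR (ln x) by rewrite lnK.
have -> : (x == c) = (ln x == ln c).
  by rewrite [in LHS]xE [in LHS]cE (inj_eq (@expR_inj R)).
rewrite xE cE !expRK; set u := ln x; set v := ln c.
rewrite /powR (gt_eqF (expR_gt0 u)) (gt_eqF (expR_gt0 v)) !expRK.
(* In terms of the logarithms u and v, the factor expR m comes out of both sides. *)
pose m := (alpha - 1) * v + u.
have -> : alpha * expR ((alpha - 1) * v) * expR u = alpha * expR m.
  by rewrite -mulrA -expRD.
have -> : expR (alpha * u) = expR m * expR ((alpha - 1) * (u - v)).
  by rewrite -expRD /m; congr expR; ring.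
have -> : expR (alpha * v) = expR m * expR (v - u).
  by rewrite -expRD /m; congr expR; ring.
have m0 := expR_gt0 m.
have -> : expR m * expR ((alpha - 1) * (u - v)) + (alpha - 1) * (expR m * expR (v - u))
   = expR m * (expR ((alpha - 1) * (u - v)) + (alpha - 1) * expR (v - u)) by ring.
apply/leifP; have [->|uv] := eqVneq u v; first by rewrite subrr mulr0 expR0; apply/eqP; ring.
rewrite mulrC ltr_pM2l//.
(* The bound 1 + y <= expR y is used at y = (alpha - 1)(u - v) and, strictly and with weight alpha -
   1, at y = v - u: the linear terms cancel and alpha remains. *)
have h1 : 1 + (alpha - 1) * (u - v) <= expR ((alpha - 1) * (u - v)) := expR_ge1Dx _.
have h2 : 1 + (v - u) < expR (v - u) by apply: expR_gt1Dx; rewrite subr_eq0 eq_sym.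
have h3 : (alpha - 1) * (1 + (v - u)) < (alpha - 1) * expR (v - u) by rewrite ltr_pM2l.
by move: h1 h3; nra.
Qed.

(** * Weights and lower bounds on effort *)

Definition weight (R : realType) (alpha : R) (gam : R -> R -> R) (t s : R) : R :=
  gam t s `^ (- (alpha - 1)^-1).

Lemma weight_ge1 (R : realType) (T alpha : R) (gam : R -> R -> R) (t s : R) :
  1 < alpha -> discount_function T gam -> 0 <= t -> t <= s -> s <= T ->
  1 <= weight alpha gam t s.
Proof.
move=> a1 gamP t0 ts sT; have /andP[g0 g1] := discount_range gamP t0 ts sT.
rewrite /weight powRN -powR_inv1 ?powR_ge0// powR_inv1 ?powR_ge0//.
rewrite -[leLHS]invr1 lef_pV2 ?posrE ?powR_gt0//.
have h : 0 <= (alpha - 1)^-1 by rewrite invr_ge0 subr_ge0 ltW.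
by have := ge0_ler_powR h (ltW g0) ler01 g1; rewrite powR1.
Qed.

(** The exponents satisfy 1 - alpha / (alpha - 1) = - 1 / (alpha - 1). This identity makes the
    cheapest velocities proportional to the weight. *)
Lemma weight_powR (R : realType) (alpha : R) (gam : R -> R -> R) (t s : R) :
  1 < alpha -> 0 < gam t s -> gam t s * weight alpha gam t s `^ alpha =
  weight alpha gam t s.
Proof.
move=> a1 g0; rewrite /weight -powRrM -{1}(powRr1 (ltW g0)) -powRD; last first.
  by rewrite (lt0r_neq0 g0) implybT.
congr powR; field; by rewrite subr_eq0 gt_eqF.
Qed.

Lemma weight_diag (R : realType) (T alpha : R) (gam : R -> R -> R) (t : R) :
  discount_function T gam -> 0 <= t <= T -> weight alpha gam t t = 1.
Proof. by move=> gamP tT; rewrite /weight (discount_diag gamP)// powR1. Qed.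

Lemma discount_within_continuous (R : realType) (T : R) (gam : R -> R -> R) (t : R) :
  discount_function T gam -> 0 <= t <= T -> {within `[t, T], continuous (gam t)}.
Proof.
move=> gamP tT; have [g _ dg] := discount_C1 gamP tT.
apply/subspace_continuousP => x; rewrite /= in_itv/= => /dg.
exact: has_derivative_within_continuous.
Qed.

Lemma weight_within_continuous (R : realType) (T alpha : R) (gam : R -> R -> R) (t : R) :
  discount_function T gam -> 0 <= t <= T ->
  {within `[t, T], continuous (weight alpha gam t)}.
Proof.
move=> gamP tT; apply/subspace_continuousP => x /[dup] xtT.
have /subspace_continuousP := discount_within_continuous gamP tT.
move=> /[apply] cg; rewrite /weight.
move: xtT tT; rewrite /= in_itv/= => /andP[tx xT] /andP[t0 _].
have /andP[g0 _] := discount_range gamP t0 tx xT.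
have c : {for gam t x, continuous (fun y => y `^ (- (alpha - 1)^-1))}.
  apply: differentiable_continuous; apply/derivable1_diffP.
  by have [] := is_derive1_powR (- (alpha - 1)^-1) g0.
exact: cvg_comp cg c.
Qed.

Lemma cost_ge0 (R : realType) (alpha v : R) : (0 <= cost alpha v)%E.
Proof. by rewrite /cost; case: ifP => // _; rewrite lee_fin powR_ge0. Qed.

Lemma ae_neq (R : realType) (a : R) : {ae @lebesgue_measure R, forall x : R, x != a}.
Proof.
exists [set a]; split => //; first exact: lebesgue_measure_set1.
by move=> x /=; apply: contra_notP => /eqP.
Qed.

Lemma ae_itv_oo (R : realType) (a b : R) (P : R -> Prop) :
  {ae @lebesgue_measure R, forall x, a < x < b -> P x} ->
  {ae @lebesgue_measure R, forall x, `[a, b]%classic x -> P x}.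
Proof.
have F := ae_filter_ringOfSetsType (@lebesgue_measure R).
move=> h; have h2 := @filterI _ _ F _ _ (ae_neq a) (ae_neq b).
apply: (@filterS2 _ _ F _ _ _ _ h h2) => x Px [xa xb].
rewrite /= in_itv/= => /andP[ax bx].
by apply: Px; rewrite !lt_neqAle ax bx xb eq_sym xa.
Qed.

(** The tangent inequality at [c] for the relative velocity v / w, multiplied by w; by hypothesis w
    (v / w)^alpha = gam v^alpha. Negative velocities cost infinitely much. *)
Lemma effort_tangent (R : realType) (alpha gam c w v : R) : 1 < alpha ->
  0 < gam -> 0 < w -> gam * w `^ alpha = w -> 0 <= c ->
  ((alpha * c `^ (alpha - 1) * v - (alpha - 1) * c `^ alpha * w)%:E
     <= gam%:E * cost alpha v)%E.
Proof.
move=> a1 g0 w0 gw c0; rewrite /cost; case: ifPn => [v0|_]; last first.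
  by rewrite gt0_muley ?lte_fin// leey.
rewrite -EFinM lee_fin.
have vw0 : 0 <= v / w by rewrite divr_ge0// ltW.
have vE : v = w * (v / w) by rewrite mulrC divfK ?gt_eqF.
have -> : gam * v `^ alpha = w * (v / w) `^ alpha.
  by rewrite [in LHS]vE powRM// ?(ltW w0)// mulrA gw.
have [+ _] := powR_tangent a1 c0 vw0; rewrite -(ler_pM2l w0) => h.
rewrite [in leLHS]vE; move: h; nra.
Qed.

Definition effort (R : realType) (T alpha : R) (gam : R -> R -> R) (t : R)
    (y : R -> R) : \bar R :=
  (\int[lebesgue_measure]_(s in `[t, T]) ((gam t s)%:E * cost alpha (derive1 y s)))%E.

Lemma effort_ge0 (R : realType) (T alpha : R) (gam : R -> R -> R) (t : R)
    (y : R -> R) : discount_function T gam -> 0 <= t ->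
  (0 <= effort T alpha gam t y)%E.
Proof.
move=> gamP t0; apply: integral_ge0 => s; rewrite /= in_itv/= => /andP[ts sT].
by rewrite mule_ge0 ?cost_ge0// lee_fin ltW//; case/andP: (discount_range gamP t0 ts sT).
Qed.

(** Integrated tangent bounds, with slope [c1] up to [m] and [c2] afterwards. A single slope gives
    the least effort; a change of slope at [m] detects a plan that is ahead of the cheapest one
    there. *)
Lemma effort_lower_bound (R : realType) (T alpha : R) (gam Gam : R -> R -> R)
    (t m c1 c2 : R) (z : R -> R) : 1 < alpha ->
  discount_function T gam -> discount_antiderivative T alpha gam Gam ->
  0 <= t -> t <= m -> m <= T -> absolutely_continuous_on t T z ->
  0 <= c1 -> 0 <= c2 ->
  ((alpha * c1 `^ (alpha - 1) * (z m - z t) -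
      (alpha - 1) * c1 `^ alpha * (Gam t m - Gam t t)
    + (alpha * c2 `^ (alpha - 1) * (z T - z m) -
      (alpha - 1) * c2 `^ alpha * (Gam t T - Gam t m)))%:E
   <= effort T alpha gam t z)%E.
Proof.
move=> a1 gamP GamP t0 tm mT acz c10 c20.
have tT := le_trans tm mT.
have tT' : 0 <= t <= T by rewrite t0.
have [g [ig zE dz]] := absolutely_continuous_FTC tT acz.
pose mu := @lebesgue_measure R.
pose phi c s := alpha * c `^ (alpha - 1) * g s - (alpha - 1) * c `^ alpha * weight alpha gam t s.
have cw := weight_within_continuous (alpha := alpha) gamP tT'.
have iw : mu.-integrable `[t, T] (EFin \o weight alpha gam t).
  by apply: continuous_compact_integrable => //; exact: segment_compact.
have igi : mu.-integrable `[t, T] (EFin \o g) by exact: integrableS ig.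
have ikg c : mu.-integrable `[t, T] (EFin \o (fun s => alpha * c `^ (alpha - 1) * g s)).
  by apply: eq_integrable (integrableZl _ (alpha * c `^ (alpha - 1)) igi) => //.
have ikw c : mu.-integrable `[t, T] (EFin \o (fun s => (alpha - 1) * c `^ alpha * weight alpha gam t s)).
  by apply: eq_integrable (integrableZl _ ((alpha - 1) * c `^ alpha) iw) => //.
have iphi c : mu.-integrable `[t, T] (EFin \o phi c).
  by apply: eq_integrable (integrableB _ (ikg c) (ikw c)) => //.
have sub p q : t <= p -> q <= T -> `[p, q] `<=` `[t, T].
  by move=> tp qT x /=; rewrite !in_itv/= => /andP[? ?]; rewrite (le_trans tp)//= (le_trans _ qT).
have sintg p q : t <= p -> p <= q -> q <= T -> \int[mu]_(s in `[p, q]) g s = z q - z p.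
  move=> tp pq qT; have tq := le_trans tp pq; have pT := le_trans pq qT.
  rewrite -Rintegral_itv_obnd_cbnd; last exact: integrableS ig.
  rewrite -(@Rintegral_itvB _ _ (BLeft t)) ?bnd_simp//; last exact: integrableS ig.
  have := zE q; have := zE p; rewrite tp tq pT qT => /(_ isT) -> /(_ isT) ->.
  by rewrite opprD addrACA subrr add0r.
have sintw p q : t <= p -> p <= q -> q <= T ->
    \int[mu]_(s in `[p, q]) weight alpha gam t s = Gam t q - Gam t p.
  have dG s (ts : t <= s) (sT : s <= T) := GamP t s t0 ts sT.
  by move=> tp pq qT; rewrite /Rintegral (has_derivative_within_integral tp pq qT cw dG).
have sintphi c p q : t <= p -> p <= q -> q <= T ->
    (alpha * c `^ (alpha - 1) * (z q - z p) -
      (alpha - 1) * c `^ alpha * (Gam t q - Gam t p))%:E =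
    (\int[mu]_(s in `[p, q]) (phi c s)%:E)%E.
  move=> tp pq qT; rewrite -[RHS]fineK; last first.
    by apply: integrable_fin_num => //; apply: integrableS (iphi c) => //; exact: sub.
  congr EFin; rewrite -/(Rintegral mu `[p, q] (phi c)) RintegralB//.
  - rewrite !RintegralZl// ?sintg ?sintw//.
      by apply: integrableS iw => //; exact: sub.
    exact: integrableS ig.
  - by apply: integrableS (ikg c) => //; exact: sub.
  - by apply: integrableS (ikw c) => //; exact: sub.
(* Positive parts make the minorant nonnegative, as the comparison of integrals requires; it stays
   below the effort integrand, which is nonnegative, and above [phi]. *)
pose psi s := if s <= m then (EFin \o phi c1)^\+%E s else (EFin \o phi c2)^\+%E s.
have psiL : {in `[t, m]%classic, psi =1 (EFin \o phi c1)^\+%E}.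
  by move=> s; rewrite inE/= in_itv/= => /andP[_ sm]; rewrite /psi sm.
have psiR : {in `]m, T]%classic, psi =1 (EFin \o phi c2)^\+%E}.
  by move=> s; rewrite inE/= in_itv/= => /andP[ms _]; rewrite /psi leNgt ms.
have UE : `[t, T]%classic = `[t, m] `|` `]m, T].
  by apply: itv_bndbnd_setU; rewrite bnd_simp.
have mphi c D : D `<=` `[t, T]%classic -> measurable_fun D (EFin \o phi c).
  by move=> Ds; apply: measurable_funS Ds _ => //; have /measurable_int := iphi c.
have subL : `[t, m] `<=` `[t, T] by exact: sub.
have subR : `]m, T] `<=` `[t, T].
  by move=> x /=; rewrite !in_itv/= => /andP[? ->]; rewrite (le_trans tm)// ltW.
have mpsi : measurable_fun `[t, T] psi.
  rewrite UE; apply/measurable_funU => //; split.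
    apply: (eq_measurable_fun (EFin \o phi c1)^\+%E) => [s /psiL//|].
    by apply: measurable_funepos; exact: mphi.
  apply: (eq_measurable_fun (EFin \o phi c2)^\+%E) => [s /psiR//|].
  by apply: measurable_funepos; exact: mphi.
have psi0 s : (0 <= psi s)%E by rewrite /psi; case: ifP => _; exact: funepos_ge0.
have phi_le c D : (\int[mu]_(s in D) (phi c s)%:E <= \int[mu]_(s in D) (EFin \o phi c)^\+%E s)%E.
  rewrite integralE -[leRHS]sube0; apply: leeB => //; apply: integral_ge0 => s _; exact: funeneg_ge0.
apply: (@le_trans _ _ (\int[mu]_(s in `[t, T]) psi s)%E).
  rewrite UE ge0_integral_setU//; last 2 first.
  - by rewrite -UE.
  - apply/disj_set2P; rewrite -subset0 => x [] /=; rewrite !in_itv/= => /andP[_ xm] /andP[mx _].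
    by have := le_lt_trans xm mx; rewrite ltxx.
  rewrite EFinD; apply: leeD.
    rewrite sintphi//; apply: le_trans (phi_le _ _) _.
    apply: ge0_le_integral_majorant => s sD; first exact: funepos_ge0.
    by rewrite psiL// inE.
  rewrite sintphi//; apply: le_trans (phi_le _ _) _.
  rewrite -integral_itv_obnd_cbnd; last by apply: measurable_funepos; exact: mphi.
  apply: ge0_le_integral_majorant => s sD; first exact: funepos_ge0.
  by rewrite psiR// inE.
apply: ae_ge0_le_integral_majorant => //.
  move=> s; rewrite /= in_itv/= => /andP[ts sT].
  by rewrite mule_ge0 ?cost_ge0// lee_fin ltW//; case/andP: (discount_range gamP t0 ts sT).
have F := ae_filter_ringOfSetsType (@lebesgue_measure R).
apply: ae_itv_oo; apply: (@filterS _ _ F _ _ _ dz) => s + /[dup] /andP[/ltW ts /ltW sT].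
move=> /[apply] [[_ dE]]; rewrite derive1E dE.
have [g0 _] := andP (discount_range gamP t0 ts sT).
have w0 : 0 < weight alpha gam t s.
  exact: lt_le_trans ltr01 (weight_ge1 a1 gamP t0 ts sT).
have phi_cost c : 0 <= c -> ((EFin \o phi c)^\+ s <= (gam t s)%:E * cost alpha (g s))%E.
  move=> c0; rewrite funeposE ge_max; apply/andP; split.
    by apply: effort_tangent => //; exact: weight_powR.
  by rewrite mule_ge0 ?cost_ge0// lee_fin ltW.
by rewrite /psi; case: ifP => _; exact: phi_cost.
Qed.

Lemma lipschitz_absolutely_continuous (R : realType) (a b K : R) (f : R -> R) :
  (forall x y, a <= x -> x <= y -> y <= b -> `|f y - f x| <= K * (y - x)) ->
  absolutely_continuous_on a b f.
Proof.
(* The maximum with 1 keeps the divisor positive whatever the sign of K. *)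
move=> lf e e0; pose K' := Num.max 1 K.
have K'0 : 0 < K' by rewrite lt_max ltr01.
exists (e / K'); first by rewrite divr_gt0.
move=> n l u lu _ sd; apply: (@le_lt_trans _ _ (\sum_(i < n) K' * (u i - l i))).
  apply: ler_sum => i _; have /and3P[al lui ub] := lu i.
  apply: le_trans (lf _ _ al lui ub) _.
  by apply: ler_wpM2r; rewrite ?subr_ge0// le_max lexx orbT.
by rewrite -mulr_sumr mulrC -ltr_pdivlMr.
Qed.

Lemma antiderivative_integral (R : realType) (T alpha : R)
    (gam Gam : R -> R -> R) (t p q : R) :
  discount_function T gam -> discount_antiderivative T alpha gam Gam ->
  0 <= t -> t <= p -> p <= q -> q <= T ->
  (\int[@lebesgue_measure R]_(s in `[p, q]) (weight alpha gam t s)%:E =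
     (Gam t q - Gam t p)%:E)%E.
Proof.
move=> gamP GamP t0 tp pq qT.
have tT : 0 <= t <= T by rewrite t0 (le_trans tp)// (le_trans pq).
have cw := weight_within_continuous (alpha := alpha) gamP tT.
have dG s (ts : t <= s) (sT : s <= T) := GamP t s t0 ts sT.
exact: has_derivative_within_integral tp pq qT cw dG.
Qed.

(** The weight is at least 1. In particular Gam_t(T) - Gam_t(t) is positive before T. *)
Lemma antiderivative_increment_ge (R : realType) (T alpha : R)
    (gam Gam : R -> R -> R) (t p q : R) : 1 < alpha ->
  discount_function T gam -> discount_antiderivative T alpha gam Gam ->
  0 <= t -> t <= p -> p <= q -> q <= T -> q - p <= Gam t q - Gam t p.
Proof.
move=> a1 gamP GamP t0 tp pq qT; rewrite -lee_fin.
rewrite -(antiderivative_integral gamP GamP t0 tp pq qT).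
have -> : ((q - p)%:E = \int[@lebesgue_measure R]_(s in `[p, q]) (cst 1%:E s))%E.
  rewrite integral_cst//= mul1e lebesgue_measure_itv/= lte_fin.
  by case: ltP => // qp; rewrite (le_anti (introT andP (conj pq qp))) subrr.
apply: ge0_le_integral_majorant => s; rewrite /= ?lee_fin ?ler01//.
rewrite in_itv/= => /andP[ps sq].
by apply: (weight_ge1 a1 gamP) => //; [exact: le_trans ps|exact: le_trans qT].
Qed.

Lemma antiderivative_increment_le (R : realType) (T alpha : R)
    (gam Gam : R -> R -> R) (t p q M : R) :
  discount_function T gam -> discount_antiderivative T alpha gam Gam ->
  0 <= t -> t <= p -> p <= q -> q <= T ->
  (forall s, t <= s -> s <= T -> weight alpha gam t s <= M) ->
  Gam t q - Gam t p <= M * (q - p).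
Proof.
move=> gamP GamP t0 tp pq qT wM; rewrite -lee_fin.
rewrite -(antiderivative_integral gamP GamP t0 tp pq qT).
have -> : ((M * (q - p))%:E = \int[@lebesgue_measure R]_(s in `[p, q]) (cst M%:E s))%E.
  rewrite integral_cst//= lebesgue_measure_itv/= lte_fin EFinM.
  by case: ltP => // qp; rewrite (le_anti (introT andP (conj pq qp))) subrr.
apply: ge0_le_integral_majorant => s; rewrite /= ?lee_fin ?powR_ge0//.
rewrite in_itv/= => /andP[ps sq].
by apply: wM => //; [exact: le_trans ps|exact: le_trans qT].
Qed.

Lemma weight_le (R : realType) (T alpha : R) (gam : R -> R -> R) (t s : R) :
  1 < alpha -> discount_function T gam -> 0 <= t -> t <= s -> s <= T ->
  weight alpha gam t s <= weight alpha gam t T.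
Proof.
move=> a1 gamP t0 ts sT; have tT := le_trans ts sT.
have /andP[g0 _] := discount_range gamP t0 tT (lexx T).
have gs := discount_nonincreasing gamP t0 ts sT (lexx T).
have g0' := lt_le_trans g0 gs.
rewrite /weight !powRN lef_pV2 ?posrE ?powR_gt0//.
apply: ge0_ler_powR; rewrite ?nnegrE ?(ltW g0) ?(ltW g0')//.
by rewrite invr_ge0 subr_ge0 ltW.
Qed.

(** Since gam_t(t) = 1, [Gam t] has initial slope 1, so a bound by c times its increments bounds the
    initial slope by c. *)
Lemma initial_derivative_le (R : realType) (T alpha : R)
    (gam Gam : R -> R -> R) (t c d : R) (z : R -> R) :
  discount_function T gam -> discount_antiderivative T alpha gam Gam ->
  0 <= t -> t < T ->
  (forall s, t <= s -> s <= T -> z s - z t <= c * (Gam t s - Gam t t)) ->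
  initial_derivative t z d -> d <= c.
Proof.
move=> gamP GamP t0 tT zc dz.
have dG : initial_derivative t (Gam t) 1.
  rewrite -(weight_diag alpha gamP (t := t)); last by rewrite t0 ltW.
  by apply: (has_derivative_within_at_right tT); apply: GamP => //; exact: ltW.
have cG : c * ((Gam t s - Gam t t) / (s - t)) @[s --> t^'+] --> c * 1.
  exact: cvgMr dG.
rewrite -(mulr1 c); apply: ler_cvg_to dz cG _; near=> s.
have ts : t < s by near: s; exact: nbhs_right_gt.
have sT : s < T by near: s; exact: nbhs_right_lt.
rewrite mulrA ler_pM2r ?invr_gt0 ?subr_gt0//; apply: zc; exact: ltW.
Unshelve. all: by end_near. Qed.

(** * Selection of a plan at a state below the goal *)

Section states.
Variables (R : realType) (T theta r alpha : R) (gam Gam : R -> R -> R).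
Hypothesis alpha_gt1 : 1 < alpha.
Hypothesis gamP : discount_function T gam.
Hypothesis GamP : discount_antiderivative T alpha gam Gam.
Variables (t x : R).
Hypothesis t_ge0 : 0 <= t.
Hypothesis t_ltT : t < T.
Hypothesis x_lt : x < theta.

Let D := Gam t T - Gam t t.
Let c := (theta - x) / D.

Let D_gt0 : 0 < D.
Proof.
apply: lt_le_trans (antiderivative_increment_ge alpha_gt1 gamP GamP t_ge0 (lexx t) (ltW t_ltT) (lexx T)).
by rewrite subr_gt0.
Qed.

Let c_gt0 : 0 < c.
Proof. by rewrite divr_gt0// subr_gt0. Qed.

Let cD : c * D = theta - x.
Proof. by rewrite divfK// gt_eqF. Qed.

Let powRB1 k : 0 <= k -> k * k `^ (alpha - 1) = k `^ alpha.
Proof. by move=> k0; apply: mulr_powRB1 => //; exact: lt_trans alpha_gt1. Qed.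

Lemma increment_gt0 m : t < m -> m <= T -> 0 < Gam t m - Gam t t.
Proof.
move=> tm mT; apply: lt_le_trans (antiderivative_increment_ge alpha_gt1 gamP GamP t_ge0 (lexx t) (ltW tm) mT).
by rewrite subr_gt0.
Qed.

(** The tangent bound with m = t and slope [c]: an increment of at least c D yields alpha c^alpha D
    - (alpha - 1) c^alpha D = c^alpha D. *)
Lemma goal_effort_ge z : absolutely_continuous_on t T z -> z t = x ->
  theta <= z T -> ((c `^ alpha * D)%:E <= effort T alpha gam t z)%E.
Proof.
move=> acz zt zT; have c0 := ltW c_gt0.
apply: le_trans (effort_lower_bound alpha_gt1 gamP GamP t_ge0 (lexx t) (ltW t_ltT) acz c0 c0).
rewrite lee_fin !subrr !mulr0 subrr add0r -/D zt.
have k0 : 0 <= alpha * c `^ (alpha - 1).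
  by rewrite mulr_ge0 ?powR_ge0// ltW// (lt_trans ltr01).
have : alpha * c `^ (alpha - 1) * (c * D) <= alpha * c `^ (alpha - 1) * (z T - x).
  by apply: ler_wpM2l => //; rewrite cD lerB.
rewrite -(powRB1 c0); lra.
Qed.

(* If z ran ahead at time m, slope k on [t, m] and c on [m, T] would give a
   lower bound on its effort exceeding the optimum. *)
Lemma goal_effort_slope z : absolutely_continuous_on t T z -> z t = x ->
  theta <= z T -> (effort T alpha gam t z <= (c `^ alpha * D)%:E)%E ->
  forall m, t <= m -> m <= T -> z m - z t <= c * (Gam t m - Gam t t).
Proof.
move=> acz zt zT zc m; rewrite le_eqVlt => /predU1P[<-|tm mT].
  by rewrite !subrr mulr0.
have D10 := increment_gt0 tm mT; set D1 := Gam t m - Gam t t in D10 *.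
rewrite leNgt; apply/negP; rewrite -ltr_pdivlMr//; set k := (z m - z t) / D1 => ck.
have k0 := lt_trans c_gt0 ck.
have := le_trans (effort_lower_bound alpha_gt1 gamP GamP t_ge0 (ltW tm) mT acz (ltW k0) (ltW c_gt0)) zc.
rewrite lee_fin -/D1.
have -> : z m - z t = k * D1 by rewrite divfK// gt_eqF.
have -> : Gam t T - Gam t m = D - D1 by rewrite /D /D1; ring.
have zTm : c * D - k * D1 <= z T - z m.
  by rewrite cD /k divfK ?gt_eqF// zt; move: zT; lra.
have k0' : 0 <= alpha * c `^ (alpha - 1).
  by rewrite mulr_ge0 ?powR_ge0// ltW// (lt_trans ltr01).
have := ler_wpM2l k0' zTm.
(* The bound exceeds the optimum by at least [D1] times the defect at [k] of the tangent inequality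
   at [c], which is positive since k differs from c. *)
have [_ /esym] := powR_tangent alpha_gt1 (ltW c_gt0) (ltW k0).
rewrite (gt_eqF ck) => kc; have := (powR_tangent alpha_gt1 (ltW c_gt0) (ltW k0)).1.
rewrite le_eqVlt -kc/= -(ltr_pM2l D10).
rewrite -(powRB1 (ltW c_gt0)) -(powRB1 (ltW k0)); lra.
Qed.

(** If z had risen by time [m], its mean slope [k] up to [m] and slope 0 afterwards would bound the
    effort below by k^alpha D1 > 0. The factor 0 is kept to match [initial_derivative_le]. *)
Lemma effort_le0_slope z : absolutely_continuous_on t T z ->
  (effort T alpha gam t z <= 0)%E ->
  forall m, t <= m -> m <= T -> z m - z t <= 0 * (Gam t m - Gam t t).
Proof.
move=> acz z0 m; rewrite le_eqVlt => /predU1P[<-|tm mT].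
  by rewrite !subrr mulr0.
have D10 := increment_gt0 tm mT; set D1 := Gam t m - Gam t t in D10 *.
rewrite mul0r leNgt; apply/negP => A0; pose k := (z m - z t) / D1.
have k0 : 0 < k by rewrite divr_gt0.
have := le_trans (effort_lower_bound alpha_gt1 gamP GamP t_ge0 (ltW tm) mT acz (ltW k0) (lexx 0)) z0.
rewrite lee_fin -/D1 !powR0 ?gt_eqF ?subr_gt0// ?(lt_trans _ alpha_gt1)//.
have -> : z m - z t = k * D1 by rewrite divfK// gt_eqF.
have := powR_gt0 alpha k0; rewrite -(ltr_pM2l D10).
rewrite -(powRB1 (ltW k0)); lra.
Qed.

(** Its velocity is [c] times the weight, the equality case of the tangent bound. *)
Definition goal_plan (s : R) : R := x + c * (Gam t s - Gam t t).

Lemma goal_plan_start : goal_plan t = x.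
Proof. by rewrite /goal_plan subrr mulr0 addr0. Qed.

Lemma goal_plan_end : goal_plan T = theta.
Proof. by rewrite /goal_plan -/D cD; ring. Qed.

Lemma goal_plan_absolutely_continuous : absolutely_continuous_on t T goal_plan.
Proof.
apply: (@lipschitz_absolutely_continuous _ _ _ (c * weight alpha gam t T)) => p q tp pq qT.
rewrite /goal_plan (_ : _ - _ = c * (Gam t q - Gam t p)); last by ring.
rewrite normrM gtr0_norm// -mulrA ler_pM2l// ger0_norm; last first.
  apply: le_trans (antiderivative_increment_ge alpha_gt1 gamP GamP t_ge0 tp pq qT).
  by rewrite subr_ge0.
apply: (antiderivative_increment_le gamP GamP t_ge0 tp pq qT) => s ts sT.
exact: weight_le.
Qed.

Lemma goal_plan_initial_derivative : initial_derivative t goal_plan c.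
Proof.
have dG : initial_derivative t (Gam t) 1.
  rewrite -(weight_diag alpha gamP (t := t)); last by rewrite t_ge0 ltW.
  by apply: (has_derivative_within_at_right t_ltT); apply: GamP => //; exact: ltW.
rewrite /initial_derivative -[X in _ --> X](mulr1 c).
have cG : c * ((Gam t s - Gam t t) / (s - t)) @[s --> t^'+] --> c * 1.
  exact: cvgMr dG.
apply: cvg_trans cG; apply: near_eq_cvg; near=> s.
by rewrite goal_plan_start /goal_plan (addrC x) addrK mulrA.
Unshelve. all: by end_near. Qed.

Lemma goal_plan_effort : effort T alpha gam t goal_plan = (c `^ alpha * D)%:E.
Proof.
pose mu := @lebesgue_measure R.
have tT : 0 <= t <= T by rewrite t_ge0 ltW.
have E : {in `]t, T[%classic, (fun s => ((gam t s)%:E * cost alpha (derive1 goal_plan s))%E) =1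
    fun s => ((c `^ alpha)%:E * (weight alpha gam t s)%:E)%E}.
  move=> s; rewrite inE/= in_itv/= => /andP[ts sT].
  have ds : is_derive s 1 goal_plan (c * weight alpha gam t s).
    have dG : is_derive s 1 (Gam t) (weight alpha gam t s).
      apply: (@has_derivative_within_interior _ t T); first by rewrite ts.
      by apply: GamP => //; exact: ltW.
    rewrite (_ : goal_plan = (fun s => (x - c * Gam t t) + c * Gam t s)); last first.
      by apply/funext => u; rewrite /goal_plan; ring.
    have := is_deriveD (is_derive_cst (x - c * Gam t t) s 1) (is_deriveZ c dG).
    by rewrite add0r.
  rewrite derive1E (@derive_val _ _ _ _ _ _ _ ds) /cost.
  have w0 : 0 <= weight alpha gam t s by exact: powR_ge0.
  rewrite mulr_ge0 ?(ltW c_gt0)// -EFinM powRM ?(ltW c_gt0)// mulrCA weight_powR//.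
  by case/andP: (discount_range gamP t_ge0 (ltW ts) (ltW sT)).
have cw := weight_within_continuous (alpha := alpha) gamP tT.
have iw : mu.-integrable `[t, T] (EFin \o weight alpha gam t).
  by apply: continuous_compact_integrable => //; exact: segment_compact.
have mG : measurable_fun `]t, T[ (fun s => ((c `^ alpha)%:E * (weight alpha gam t s)%:E)%E).
  apply: (measurable_funS (E := `[t, T]%classic)) => //; first exact: subset_itv_oo_cc.
  by apply: (@measurable_int _ _ _ mu); apply: (integrableZl _ (c `^ alpha) iw).
transitivity (\int[mu]_(s in `[t, T]) ((c `^ alpha)%:E * (weight alpha gam t s)%:E))%E.
  (* The derivative is computed in the open interval only, so the endpoints are dropped from both
     integrals. *)
  rewrite /effort integral_itv_bndoo; last by apply: eq_measurable_fun mG => s /E.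
  rewrite [RHS]integral_itv_bndoo//; apply: eq_integral => s; exact: E.
rewrite integralZl//.
by rewrite (antiderivative_integral gamP GamP)// ltW.
Qed.

Lemma constant_plan_effort : effort T alpha gam t (cst x) = 0%E.
Proof.
rewrite /effort; apply: integral0_eq => s _.
by rewrite derive1_cst /cost lexx powR0 ?mule0// gt_eqF// (lt_trans _ alpha_gt1).
Qed.

Lemma constant_plan : plan T t x (cst x).
Proof.
split => //; apply: (@lipschitz_absolutely_continuous _ _ _ 0) => p q _ _ _.
by rewrite subrr normr0 mul0r.
Qed.

Lemma constant_plan_perceived_cost : perceived_cost T theta r alpha gam t (cst x) = 0%E.
Proof.
rewrite /perceived_cost -/(effort T alpha gam t _) constant_plan_effort.
by rewrite leNgt x_lt mulr0 sube0.
Qed.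

Lemma goal_plan_perceived_cost : perceived_cost T theta r alpha gam t goal_plan =
  (c `^ alpha * D - gam t T * r)%:E.
Proof.
rewrite /perceived_cost -/(effort T alpha gam t _) goal_plan_effort.
by rewrite goal_plan_end lexx mulr1 EFinB.
Qed.

Lemma goal_perceived_cost z : theta <= z T ->
  perceived_cost T theta r alpha gam t z = (effort T alpha gam t z - (gam t T * r)%:E)%E.
Proof. by move=> zT; rewrite /perceived_cost zT mulr1. Qed.

Lemma giveup_perceived_cost z : z T < theta ->
  perceived_cost T theta r alpha gam t z = effort T alpha gam t z.
Proof. by move=> zT; rewrite /perceived_cost leNgt zT mulr0 sube0. Qed.

(** The comparison of effort with reward is multiplied by D^(alpha - 1), using theta - x = c D. *)
Lemma goal_worthwhileE :
  ((theta - x) `^ alpha <= r * zeta T alpha gam Gam t) =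
  (c `^ alpha * D <= gam t T * r).
Proof.
rewrite /zeta -/D -cD powRM ?(ltW c_gt0) ?(ltW D_gt0)//.
rewrite -(powRB1 (ltW D_gt0)) (mulrA (c `^ alpha)) mulrA (mulrC r).
by rewrite ler_pM2r// powR_gt0.
Qed.

(** A plan reaching the goal is compared with [goal_plan]; one that gives up is compared with the
    constant plan, so its effort is at most 0 and it never rises above its start. *)
Lemma optimal_plan_derivative_le z d :
  optimal_plan T theta r alpha gam t x z -> initial_derivative t z d -> d <= c.
Proof.
move=> [[acz zt] optz]; apply: (initial_derivative_le gamP GamP t_ge0 t_ltT).
have [zT|zT] := leP theta (z T).
  apply: goal_effort_slope => //.
  have := optz _ (conj goal_plan_absolutely_continuous goal_plan_start).
  by rewrite goal_plan_perceived_cost goal_perceived_cost// EFinB leeD2rE.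
have := optz _ constant_plan.
rewrite constant_plan_perceived_cost giveup_perceived_cost// => z0 m tm mT.
apply: le_trans (effort_le0_slope acz z0 tm mT) _.
rewrite mul0r mulr_ge0 ?(ltW c_gt0)//.
apply: le_trans (antiderivative_increment_ge alpha_gt1 gamP GamP t_ge0 (lexx t) tm mT).
by rewrite subr_ge0.
Qed.

(** Here reaching the goal costs strictly more than it pays, so an optimal plan gives up and never
    rises. *)
Lemma optimal_plan_derivative_le0 z d : r * zeta T alpha gam Gam t < (theta - x) `^ alpha ->
  optimal_plan T theta r alpha gam t x z -> initial_derivative t z d -> d <= 0.
Proof.
rewrite ltNge goal_worthwhileE -ltNge => dear [[acz zt] optz].
apply: (initial_derivative_le gamP GamP t_ge0 t_ltT).
have := optz _ constant_plan; rewrite constant_plan_perceived_cost.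
have [zT|zT] := leP theta (z T); last first.
  by rewrite giveup_perceived_cost//; exact: effort_le0_slope.
rewrite goal_perceived_cost// leNgt => /negP[]; rewrite sube_gt0.
by apply: lt_le_trans (goal_effort_ge acz zt zT); rewrite lte_fin.
Qed.

(** The weak inequality includes the tie with standing still, which is broken in favour of
    [goal_plan] because [c] bounds the initial derivatives of all optimal plans. *)
Lemma selected_goal_plan : (theta - x) `^ alpha <= r * zeta T alpha gam Gam t ->
  selected_plan T theta r alpha gam t x goal_plan c.
Proof.
rewrite goal_worthwhileE => cheap; split.
- split; first by split; [exact: goal_plan_absolutely_continuous|exact: goal_plan_start].
  move=> z [acz zt]; rewrite goal_plan_perceived_cost.
  have [zT|zT] := leP theta (z T).
    by rewrite goal_perceived_cost// EFinB leeB// goal_effort_ge.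
  rewrite giveup_perceived_cost//; apply: le_trans (effort_ge0 _ _ gamP t_ge0).
  by rewrite lee_fin subr_le0.
- exact: goal_plan_initial_derivative.
- by move=> z d'; exact: optimal_plan_derivative_le.
Qed.

Lemma selected_constant_plan : r * zeta T alpha gam Gam t < (theta - x) `^ alpha ->
  selected_plan T theta r alpha gam t x (cst x) 0.
Proof.
move=> dear; have := dear; rewrite ltNge goal_worthwhileE -ltNge => dear'; split.
- split; first exact: constant_plan.
  move=> z [acz zt]; rewrite constant_plan_perceived_cost.
  have [zT|zT] := leP theta (z T); last by rewrite giveup_perceived_cost// effort_ge0.
  rewrite goal_perceived_cost// sube_ge0//.
  by apply: le_trans (goal_effort_ge acz zt zT); rewrite lee_fin ltW.
- rewrite /initial_derivative (_ : (fun s => _) = cst 0); first exact: cvg_cst.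
  by apply/funext => s; rewrite subrr mul0r.
- by move=> z d'; exact: optimal_plan_derivative_le0.
Qed.

End states.

(** * The path of an agent who never gives up *)

(** Joint continuity on the triangle is applied along a path that stays inside it, so that the limit
    within the triangle becomes a two-sided one. *)
Lemma weight_path_continuous (R : realType) (T alpha : R) (gam : R -> R -> R)
    (p q : R -> R) : discount_function T gam -> continuous p -> continuous q ->
  (forall x, [&& 0 <= p x, p x <= q x & q x <= T]) ->
  continuous (fun x => weight alpha gam (p x) (q x)).
Proof.
move=> gamP cp cq pq x.
have /subspace_continuousP/(_ (p x, q x) (pq x)) cg := discount_continuous gamP.
have cpq : (p y, q y) @[y --> x] --> within [set p : R * R | [&& 0 <= p.1, p.1 <= p.2 & p.2 <= T]] (nbhs (p x, q x)).
  move=> P; rewrite /within/= => nP.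
  have h : (p y, q y) @[y --> x] --> (p x, q x) by exact: (cvg_pair (cp x) (cq x)).
  have := h _ nP.
  change ((\forall y \near x, [&& 0 <= p y, p y <= q y & q y <= T] -> P (p y, q y)) ->
    \forall y \near x, P (p y, q y)).
  by apply: filterS => y; apply; exact: pq.
have cg' : gam (p y) (q y) @[y --> x] --> gam (p x) (q x) := cvg_comp _ _ cpq cg.
have /and3P[p0 pqx qT] := pq x.
have /andP[g0 _] := discount_range gamP p0 pqx qT.
have c : {for gam (p x) (q x), continuous (fun y => y `^ (- (alpha - 1)^-1))}.
  apply: differentiable_continuous; apply/derivable1_diffP.
  by have [] := is_derive1_powR (- (alpha - 1)^-1) g0.
exact: cvg_comp cg' c.
Qed.

(** The weight is largest at s = T, where it is continuous in t on a compact interval. *)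
Lemma weight_bounded (R : realType) (T alpha : R) (gam : R -> R -> R) :
  0 <= T -> 1 < alpha -> discount_function T gam ->
  exists2 M, 0 < M & forall t s, 0 <= t -> t <= s -> s <= T -> weight alpha gam t s <= M.
Proof.
move=> T0 a1 gamP.
have cw : continuous (fun t => weight alpha gam (clamp 0 T t) T).
  apply: (weight_path_continuous gamP (q := cst T)).
  - exact: continuous_clamp.
  - by move=> ?; exact: cvg_cst.
  - by move=> t; have /andP[-> ->] := clamp_in t T0; rewrite lexx.
have [m _ mmax] := EVT_max T0 (continuous_subspaceT cw).
exists (Num.max 1 (weight alpha gam (clamp 0 T m) T)).
  by rewrite lt_max ltr01.
move=> t s t0 ts sT; apply: le_trans (weight_le a1 gamP t0 ts sT) _.
have tT : 0 <= t <= T by rewrite t0 (le_trans ts).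
rewrite le_max; apply/orP; right; have := mmax t; rewrite clamp_id//.
by apply; rewrite in_itv.
Qed.

Definition horizon (R : realType) (T : R) (Gam : R -> R -> R) (t : R) : R :=
  Gam t T - Gam t t.

(** The domain of integration [t, T] varies with t. Extending the integrand by its diagonal value 1
    to the left of t gives the fixed domain [0, T], at the price of subtracting t, and continuity
    under the integral sign applies. *)
Lemma horizon_continuous (R : realType) (T alpha : R) (gam Gam : R -> R -> R) :
  0 <= T -> 1 < alpha -> discount_function T gam ->
  discount_antiderivative T alpha gam Gam -> forall t, 0 <= t <= T ->
  {for t, continuous (fun t => horizon T Gam (clamp 0 T t))}.
Proof.
move=> T0 a1 gamP GamP t tT.
pose mu := @lebesgue_measure R.
pose W t s := weight alpha gam (clamp 0 T t) (Num.max (clamp 0 T t) (clamp 0 T s)).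
have [M M0 wM] := weight_bounded T0 a1 gamP.
have in_tri u s : [&& 0 <= clamp 0 T u, clamp 0 T u <= Num.max (clamp 0 T u) (clamp 0 T s)
    & Num.max (clamp 0 T u) (clamp 0 T s) <= T].
  have /andP[-> uT] := clamp_in u T0; have /andP[_ sT] := clamp_in s T0.
  by rewrite le_max lexx/= ge_max uT sT.
have cl : continuous (@clamp R 0 T) := @continuous_clamp R 0 T.
have cW1 u : continuous (W u).
  apply: (weight_path_continuous gamP (p := cst (clamp 0 T u))) => //.
  - by move=> ?; exact: cvg_cst.
  - move=> y; apply: (@continuous_max R R (cst (clamp 0 T u)) (clamp 0 T)); last exact: cl.
    exact: cvg_cst.
  - by move=> s; exact: in_tri.
have cW2 s : continuous (W ^~ s).
  apply: (weight_path_continuous gamP (p := clamp 0 T)) => //.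
  move=> y; apply: (@continuous_max R R (clamp 0 T) (cst (clamp 0 T s))); first exact: cl.
  exact: cvg_cst.
have iW u : mu.-integrable `[0, T] (EFin \o W u).
  apply: continuous_compact_integrable; first exact: segment_compact.
  exact: continuous_subspaceT.
have HE u : horizon T Gam (clamp 0 T u) = \int[mu]_(s in `[0, T]) W u s - clamp 0 T u.
  have /andP[u0 uT] := clamp_in u T0; set v := clamp 0 T u in u0 uT *.
  have vT : 0 <= v <= T by rewrite u0.
  have E1 : \int[mu]_(s in `[0, v]) W u s = v.
    transitivity (\int[mu]_(s in `[0, v]) (cst 1 s)).
      apply: eq_Rintegral => s; rewrite inE/= in_itv/= => /andP[s0 sv].
      rewrite /W -/v clamp_id ?s0 ?(le_trans sv)// max_l//.
      by rewrite (weight_diag alpha gamP).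
    rewrite Rintegral_cst//= mul1r lebesgue_measure_itv/= lte_fin.
    by case: ltP => [_|v0]; rewrite ?sube0//=; apply/le_anti; rewrite u0 v0.
  have E2 : \int[mu]_(s in `]v, T]) W u s = horizon T Gam v.
    transitivity (\int[mu]_(s in `]v, T]) weight alpha gam v s).
      apply: eq_Rintegral => s; rewrite inE/= in_itv/= => /andP[/ltW vs sT].
      by rewrite /W -/v (@clamp_id _ _ _ s) ?sT ?(le_trans u0)// max_r.
    have cw := weight_within_continuous (alpha := alpha) gamP vT.
    have iw : mu.-integrable `[v, T] (EFin \o weight alpha gam v).
      by apply: continuous_compact_integrable => //; exact: segment_compact.
    rewrite Rintegral_itv_obnd_cbnd; last first.
      by apply: integrableS iw => //; exact: subset_itv_oc_cc.
    by rewrite /Rintegral (antiderivative_integral gamP GamP).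
  have := Rintegral_itvB (iW u) (x := v); rewrite !bnd_simp => /(_ u0 uT).
  by rewrite E1 E2 => ->.
rewrite (_ : (fun t => _) = fun u => \int[mu]_(s in `[0, T]) W u s - clamp 0 T u); last first.
  by apply/funext => u; exact: HE.
apply: cvgB; last exact: cl.
(* The open parameter interval ]-1, T + 1[ leaves room around the endpoints of [0, T]; the
   dominating function is the constant [M]. *)
have := @continuity_under_integral R _ _ mu W `[0, T]%classic (measurable_itv _) (- 1) (T + 1).
move=> /(_ (fun u _ => iW u)) h; apply: (h _ (cst M)).
- by apply: aeW => s _ u _; exact: cW2.
- apply: continuous_compact_integrable; first exact: segment_compact.
  by apply: continuous_subspaceT => ?; exact: cvg_cst.
- move=> u _; apply: aeW => s _; rewrite ger0_norm ?powR_ge0//.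
  by have /and3P[? ? ?] := in_tri u s; exact: wM.
- by rewrite inE/= in_itv/=; case/andP: tT => ? ?; apply/andP; split; lra.
Qed.

Section active_path.
Variables (R : realType) (T theta alpha : R) (gam Gam : R -> R -> R).
Hypothesis T_gt0 : 0 < T.
Hypothesis theta_gt0 : 0 < theta.
Hypothesis alpha_gt1 : 1 < alpha.
Hypothesis gamP : discount_function T gam.
Hypothesis GamP : discount_antiderivative T alpha gam Gam.

Let T_ge0 : 0 <= T := ltW T_gt0.

Lemma horizon_ge t : 0 <= t <= T -> T - t <= horizon T Gam t.
Proof.
by move=> /andP[t0 tT]; exact: (antiderivative_increment_ge alpha_gt1 gamP GamP).
Qed.

Lemma horizon_gt0 t : 0 <= t -> t < T -> 0 < horizon T Gam t.
Proof.
move=> t0 tT; apply: lt_le_trans (horizon_ge _); first by rewrite subr_gt0.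
by rewrite t0 ltW.
Qed.

Lemma horizon_le : exists2 M, 0 < M & forall t, 0 <= t <= T -> horizon T Gam t <= M * (T - t).
Proof.
have [M M0 wM] := weight_bounded T_ge0 alpha_gt1 gamP; exists M => // t /andP[t0 tT].
apply: (antiderivative_increment_le gamP GamP) => // s ts sT; exact: wM.
Qed.

(* Clamping makes the rate continuous in a two-sided sense at time 0. *)
Let rate t : R := (horizon T Gam (clamp 0 T t))^-1.

Let rateE t : 0 <= t <= T -> rate t = (horizon T Gam t)^-1.
Proof. by move=> tT; rewrite /rate clamp_id. Qed.

Let rate_ge0 t : 0 <= rate t.
Proof.
have /andP[c0 cT] := clamp_in t T_ge0.
rewrite /rate invr_ge0; apply: le_trans (horizon_ge _); last by rewrite c0.
by rewrite subr_ge0.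
Qed.

Let rate_continuous t : 0 <= t -> t < T -> {for t, continuous rate}.
Proof.
move=> t0 tT; have tT' : 0 <= t <= T by rewrite t0 ltW.
apply: cvgV; last exact: (horizon_continuous T_ge0 alpha_gt1 gamP GamP tT').
by rewrite clamp_id// gt_eqF// horizon_gt0.
Qed.

Let mu := @lebesgue_measure R.

Let rate_integrable b : 0 <= b -> b < T -> mu.-integrable `[0, b] (EFin \o rate).
Proof.
move=> b0 bT; apply: continuous_compact_integrable; first exact: segment_compact.
apply: continuous_in_subspaceT => t; rewrite inE/= in_itv/= => /andP[t0 tb].
by apply: rate_continuous => //; exact: le_lt_trans bT.
Qed.

Let I t : R := \int[mu]_(s in `[0, t]) rate s.

Lemma rate_integralE t : 0 <= t -> t < T -> rate_integral T Gam t = (I t)%:E.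
Proof.
move=> t0 tT; rewrite /I /Rintegral fineK; last first.
  by apply: integrable_fin_num => //; exact: rate_integrable.
apply: eq_integral => s; rewrite inE/= in_itv/= => /andP[s0 st].
by rewrite rateE// s0 (le_trans st)// ltW.
Qed.

Let I0 : I 0 = 0.
Proof. by rewrite /I set_itv1 Rintegral_set1. Qed.

Let I_derive t : 0 < t -> t < T -> is_derive t 1 I (horizon T Gam t)^-1.
Proof.
(* An upper end beyond t but before T, up to which the rate is integrable. *)
move=> t0 tT; pose u := (t + T) / 2.
have tu : t < u by rewrite /u; lra.
have uT : u < T by rewrite /u; lra.
have u0 : 0 <= u by rewrite ltW// (lt_trans t0).
have [dI I'] := continuous_FTC1_closed tu (rate_integrable u0 uT) t0 (rate_continuous (ltW t0) tT).
by apply: DeriveDef => //; rewrite -derive1E I' rateE// !ltW.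
Qed.

Let I_continuous b : 0 <= b -> b < T -> {within `[0, b], continuous I}.
Proof.
move=> b0 bT; exact: (parameterized_integral_continuous b0 (rate_integrable b0 bT)).
Qed.

(** Since the horizon is at most M (T - t), the rate is at least 1 / (M (T - t)), whose integral
    diverges logarithmically at T. *)
Let I_unbounded A : exists b, [/\ 0 <= b, b < T & forall t, b <= t -> t < T -> A <= I t].
Proof.
have [M M0 hM] := horizon_le.
have E0 : 0 < T * expR (- (M * A)) by rewrite mulr_gt0 ?expR_gt0.
(* From this time on T - t <= T exp(- M A), which makes (ln T - ln(T - t)) / M at least A. *)
exists (Num.max 0 (T - T * expR (- (M * A)))).
split; first by rewrite le_max lexx.
  by rewrite gt_max T_gt0 gtrBl.
move=> t; rewrite ge_max => /andP[t0 tA] tT.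
have Tt : 0 < T - t by rewrite subr_gt0.
(* Nondecreasing by the bound on the horizon; its values at 0 and t bound [I t] from below. *)
pose f s := I s + M^-1 * ln (T - s).
have dln s : s < T -> is_derive s 1 (fun s => ln (T - s)) (- (T - s)^-1).
  move=> sT; have Ts : 0 < T - s by rewrite subr_gt0.
  have dl : is_derive s 1 (fun s => T - s) (- 1).
    have := is_deriveB (is_derive_cst T s 1) (is_derive_id s 1).
    by rewrite sub0r.
  have := @is_derive1_comp _ (@ln R) (fun s => T - s) s _ _ (is_derive1_ln Ts) dl.
  by rewrite mulrN1.
have df s : 0 < s -> s < T -> is_derive s 1 f ((horizon T Gam s)^-1 - M^-1 * (T - s)^-1).
  move=> s0 sT; have := is_deriveD (I_derive s0 sT) (is_deriveZ M^-1 (dln s sT)).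
  by rewrite scalerN.
have cln : {within `[0, t], continuous (fun s => ln (T - s))}.
  apply: continuous_in_subspaceT => s; rewrite inE/= in_itv/= => /andP[_ st].
  apply: differentiable_continuous; apply/derivable1_diffP.
  by have [] := dln s (le_lt_trans st tT).
have cf : {within `[0, t], continuous f}.
  by move=> s; apply: cvgD; [exact: I_continuous|apply: cvgMr; exact: cln].
have : f 0 <= f t.
  apply: (ger0_derive1_le_cc _ _ cf) => //; rewrite ?in_itv/= ?lexx ?t0//.
  - by move=> s; rewrite in_itv/= => /andP[s0 st]; have [] := df s s0 (lt_trans st tT).
  - move=> s; rewrite in_itv/= => /andP[s0 st]; have sT := lt_trans st tT.
    have [_ dE] := df s s0 sT; rewrite derive1E dE subr_ge0 -invfM.
    have h1 := horizon_gt0 (ltW s0) sT.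
    have h2 : 0 < M * (T - s) by rewrite mulr_gt0 ?subr_gt0.
    by rewrite lef_pV2 ?posrE//; apply: hM; rewrite !ltW.
rewrite /f I0 add0r subr0 => h.
have lnA : ln (T - t) <= ln T - M * A.
  have -> : ln T - M * A = ln (T * expR (- (M * A))).
    by rewrite lnM ?posrE ?expR_gt0// expRK.
  by rewrite ler_ln ?posrE//; lra.
have : M^-1 * ln (T - t) <= M^-1 * (ln T - M * A) by rewrite ler_pM2l ?invr_gt0.
rewrite mulrBr mulKf ?gt_eqF//; lra.
Qed.

Lemma rate_integral_end : rate_integral T Gam T = +oo%E.
Proof.
apply/eqyP => A _; have [b [b0 bT h]] := I_unbounded A.
apply: (@le_trans _ _ (I b)%:E); first by rewrite lee_fin h.
rewrite -rate_integralE// /rate_integral [leLHS]integral_mkcond [leRHS]integral_mkcond.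
have rE s : `[0, T]%classic s -> (0 <= ((Gam s T - Gam s s)^-1)%:E)%E.
  by rewrite /= in_itv/= => sT; rewrite lee_fin -/(horizon T Gam s) -rateE.
have sub : `[0, b] `<=` `[0, T].
  by move=> s /=; rewrite !in_itv/= => /andP[-> /le_trans]; apply; exact: ltW.
apply: ge0_le_integral_majorant => s _.
  by rewrite patchE; case: ifPn => // /set_mem/sub; exact: rE.
rewrite !patchE; case: ifPn => [/set_mem/sub sT|_]; first by rewrite mem_set.
by case: ifPn => // /set_mem; exact: rE.
Qed.

(* The distance to the goal of an agent who never gives up. *)
Definition gap (t : R) : R := theta * fine (expeR (- rate_integral T Gam t)).

Lemma gapE t : 0 <= t -> t < T -> gap t = theta * expR (- I t).
Proof. by move=> t0 tT; rewrite /gap rate_integralE. Qed.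

Lemma gap0 : gap 0 = theta.
Proof. by rewrite gapE// I0 oppr0 expR0 mulr1. Qed.

Lemma gap_end : gap T = 0.
Proof. by rewrite /gap rate_integral_end/= mulr0. Qed.

Lemma gap_gt0 t : 0 <= t -> t < T -> 0 < gap t.
Proof. by move=> t0 tT; rewrite gapE// mulr_gt0// expR_gt0. Qed.

Lemma gap_derive t : 0 < t -> t < T -> is_derive t 1 gap (- (gap t / horizon T Gam t)).
Proof.
move=> t0 tT.
have dN : is_derive t 1 (fun s => - I s) (- (horizon T Gam t)^-1).
  exact: is_deriveN (I_derive t0 tT).
have dE := @is_derive1_comp _ expR (fun s => - I s) t _ _ (is_derive_expR _) dN.
have dG : is_derive t 1 (fun s => theta * expR (- I s)) (- (gap t / horizon T Gam t)).
  have -> : - (gap t / horizon T Gam t) = theta * (expR (- I t) * - (horizon T Gam t)^-1).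
    by rewrite gapE ?ltW//; ring.
  by have := is_deriveZ theta dE.
apply: near_eq_is_derive dG; near=> s; rewrite gapE//.
  by apply: ltW; near: s; exact: lt_nbhsr.
by near: s; exact: lt_nbhsl.
Unshelve. all: by end_near. Qed.

Lemma gap_within_continuous : {within `[0, T], continuous gap}.
Proof.
apply/subspace_continuousP => t /= tT; apply/cvgrPdist_lt => e e0.
move: tT; rewrite in_itv/= => /andP[t0].
rewrite le_eqVlt => /predU1P[->|tT].
  (* Once I s >= theta / e, the bound expR (I s) >= 1 + I s gives theta expR (- I s) < e. *)
  have [b [b0 bT h]] := I_unbounded (theta / e).
  rewrite near_withinE; near=> s; rewrite /= in_itv/= => /andP[s0].
  move=> sT; change (`|gap T - gap s| < e); move: sT.
  rewrite gap_end sub0r normrN le_eqVlt => /predU1P[->|sT].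
    by rewrite gap_end normr0.
  have bs : b <= s by apply: ltW; near: s; exact: lt_nbhsr.
  rewrite gtr0_norm ?gap_gt0// gapE// expRN.
  rewrite ltr_pdivrMr ?expR_gt0//.
  have := h s bs sT; rewrite ler_pdivrMr// => h1.
  have h2 := expR_ge1Dx (I s).
  apply: (@lt_le_trans _ _ (e * (1 + I s))); first by lra.
  by rewrite ler_pM2l.
(* Before T, continuity is inherited from [I] on [0, b] with t < b < T. *)
have [b tb bT] : exists2 b, t < b & b < T.
  by exists ((t + T) / 2); lra.
have b0 : 0 <= b by rewrite ltW// (le_lt_trans t0).
have := @I_continuous b b0 bT => /subspace_continuousP/(_ t).
rewrite /= in_itv/= t0 (ltW tb) => /(_ isT) cI.
have cg : theta * expR (- I s) @[s --> within `[0, b]%classic (nbhs t)] --> theta * expR (- I t).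
  apply: cvgMr; apply: (cvg_comp (fun s => - I s) expR); first by apply: cvgN; exact: cI.
  exact: continuous_expR.
have := cg => /cvgrPdist_lt /(_ e e0); rewrite !near_withinE => cg'.
near=> s; rewrite /= in_itv/= => /andP[s0 sT].
have sb : s < b by near: s; exact: lt_nbhsl.
change (`|gap t - gap s| < e); rewrite !gapE// ?(lt_trans sb)//.
by apply: (near cg' s) => //; rewrite /= in_itv/= s0 ltW.
Unshelve. all: by end_near. Qed.

Lemma gap_nonincreasing s t : 0 <= s -> s <= t -> t <= T -> gap t <= gap s.
Proof.
move=> s0 st tT; apply: (ler0_derive1_le_cc _ _ gap_within_continuous) => //;
  rewrite ?in_itv/= ?s0 ?tT ?(le_trans st)// ?(le_trans s0)//.
- by move=> u; rewrite in_itv/= => /andP[u0 uT]; have [] := gap_derive u0 uT.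
- move=> u; rewrite in_itv/= => /andP[u0 uT]; have [_ dE] := gap_derive u0 uT.
  by rewrite derive1E dE oppr_le0 divr_ge0// ltW// ?gap_gt0 ?horizon_gt0// ltW.
Qed.

End active_path.

(** * Trajectories *)

(** Induction on the number of intervals: the others lie to the left or to the right of the first
    one, p, and the two groups are bounded by the increments of f over [a, p.1] and [p.2, b]. *)
Lemma nondecreasing_sum_subintervals (R : realType) (a b : R) (f : R -> R)
    (s : seq (R * R)) : a <= b ->
  (forall x y, a <= x -> x <= y -> y <= b -> f x <= f y) ->
  subintervals a b s -> \sum_(p <- s) (f p.2 - f p.1) <= f b - f a.
Proof.
move: {2}(size s) (leqnn (size s)) => n; elim: n a b s => [|n ih] a b s.
  rewrite leqn0 size_eq0 => /eqP-> ab ndf _; rewrite big_nil subr_ge0; exact: ndf.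
case: s => [_ ab ndf _|p s]; first by rewrite big_nil subr_ge0; exact: ndf.
rewrite ltnS => sn ab ndf /andP[/= /andP[/and3P[ap p12 pb] sab] /andP[ps dis]].
rewrite big_cons (bigID (fun q => q.2 <= p.1))/=.
rewrite -!(big_filter s); set sl := seq.filter _ s; set sr := seq.filter _ s.
have sub (P : pred (R * R)) a' b' : (forall q, q \in s -> P q -> [&& a' <= q.1, q.1 <= q.2 & q.2 <= b']) ->
    subintervals a' b' (seq.filter P s).
  move=> h; rewrite /subintervals (subseq_pairwise (filter_subseq _ _))// andbT.
  by apply/allP => q; rewrite mem_filter => /andP[Pq qs]; exact: h.
have hl : \sum_(q <- sl) (f q.2 - f q.1) <= f p.1 - f a.
  apply: ih => //.
  - by rewrite (leq_trans _ sn)// size_filter count_size.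
  - by move=> x y ax xy yp; apply: ndf => //; rewrite (le_trans yp)// (le_trans p12).
  - by apply: sub => q qs ->; have /and3P[-> -> _] := allP sab q qs.
have hr : \sum_(q <- sr) (f q.2 - f q.1) <= f b - f p.2.
  apply: ih => //.
  - by rewrite (leq_trans _ sn)// size_filter count_size.
  - by move=> x y px xy yb; apply: ndf => //; rewrite (le_trans ap)// (le_trans p12).
  - apply: sub => q qs nq; have /and3P[_ -> ->] := allP sab q qs.
    by have := allP ps q qs; rewrite /nonoverlapping (negbTE nq) orbF => ->.
move: hl hr; lra.
Qed.

(** Serves for functions whose Lipschitz constants may blow up at b. By monotonicity the part of the
    sum beyond c is at most f b - f c, which is small. *)
Lemma nondecreasing_absolutely_continuous (R : realType) (a b : R) (f : R -> R) :
  (forall x y, a <= x -> x <= y -> y <= b -> f x <= f y) ->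
  (forall c, a <= c -> c < b -> absolutely_continuous_on a c f) ->
  (forall e, 0 < e -> exists c, [/\ a <= c, c < b & f b - f c < e]) ->
  absolutely_continuous_on a b f.
Proof.
move=> ndf acf lf e e0; have e20 : 0 < e / 2 by rewrite divr_gt0.
have [c [ac cb fc]] := lf _ e20; have [d d0 h] := acf c ac cb _ e20.
exists d => // n l u lu tlu sd.
have splitf x : a <= x -> x <= b -> f x = f (clamp a c x) + f (clamp c b x) - f c.
  move=> ax xb; have [xc|/ltW cx] := leP x c.
    rewrite (@clamp_id _ a c) ?ax//.
    have -> : clamp c b x = c by rewrite /clamp; apply/max_idPl; rewrite ge_min xc orbT.
    by ring.
  rewrite (@clamp_id _ c b) ?cx//.
  have -> : clamp a c x = c by rewrite /clamp (min_idPl cx); apply/max_idPr.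
  by ring.
have acb : a <= b by rewrite (le_trans ac)// ltW.
have cb' := ltW cb.
have h1 : \sum_(i < n) `|f (clamp a c (u i)) - f (clamp a c (l i))| < e / 2.
  apply: (h n (clamp a c \o l) (clamp a c \o u)) => /=.
  - move=> i; have /andP[-> _] := clamp_in (l i) ac.
    have /andP[_ ->] := clamp_in (u i) ac; rewrite clamp_nondecreasing//.
    by case/and3P: (lu i).
  - exact: clamp_trivIset.
  - apply: le_lt_trans sd; apply: ler_sum => i _; apply: clamp_sub.
    by case/and3P: (lu i).
have h2 : \sum_(i < n) (f (clamp c b (u i)) - f (clamp c b (l i))) <= f b - f c.
  have lu' i : [&& c <= clamp c b (l i), clamp c b (l i) <= clamp c b (u i) & clamp c b (u i) <= b].
    have /andP[-> _] := clamp_in (l i) cb'.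
    have /andP[_ ->] := clamp_in (u i) cb'; rewrite clamp_nondecreasing//.
    by case/and3P: (lu i).
  rewrite (@sum_nondegenerate _ _ (clamp c b \o l) (clamp c b \o u) (fun p => f p.2 - f p.1))//=.
  - apply: nondecreasing_sum_subintervals => //.
      by move=> x y cx; apply: ndf; exact: le_trans cx.
    by apply: (@subintervals_of_trivIset _ _ _ _ (clamp c b \o l) (clamp c b \o u)) => //; exact: clamp_trivIset.
  - by move=> i; case/and3P: (lu' i).
  - by move=> x; rewrite subrr.
apply: le_lt_trans (_ : \sum_(i < n) `|f (clamp a c (u i)) - f (clamp a c (l i))| +
    \sum_(i < n) (f (clamp c b (u i)) - f (clamp c b (l i))) < e); last first.
  by move: h1 h2 fc; lra.
rewrite -big_split/=; apply: ler_sum => i _; have /and3P[al lui ub] := lu i.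
rewrite (splitf (u i)) ?(le_trans al)// (splitf (l i)) ?(le_trans lui)//.
rewrite (_ : _ - _ = f (clamp a c (u i)) - f (clamp a c (l i)) +
   (f (clamp c b (u i)) - f (clamp c b (l i)))); last by ring.
apply: le_trans (ler_normD _ _) _; rewrite lerD2l ger0_norm// subr_ge0.
have /andP[c1 _] := clamp_in (l i) cb'; have /andP[_ c2] := clamp_in (u i) cb'.
by apply: ndf; rewrite ?(le_trans ac)// clamp_nondecreasing.
Qed.

Lemma absolutely_continuous_onW (R : realType) (a b c d : R) (f : R -> R) :
  a <= c -> d <= b -> absolutely_continuous_on a b f ->
  absolutely_continuous_on c d f.
Proof.
move=> ac db acf e e0; have [k k0 h] := acf e e0; exists k => // n l u lu.
apply: h => i; have /and3P[cl -> ud] := lu i.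
by rewrite (le_trans ac)//= (le_trans ud).
Qed.

(** Absolute continuity excludes a singular part: the increment is the integral of the derivative,
    which agrees almost everywhere with its positive part. *)
Lemma absolutely_continuous_nondecreasing (R : realType) (a b : R) (f : R -> R) :
  a <= b -> absolutely_continuous_on a b f ->
  {ae @lebesgue_measure R, forall x, a < x < b ->
     exists2 d, is_derive x 1 f d & 0 <= d} ->
  f a <= f b.
Proof.
move=> ab acf df; have [g [ig fE dg]] := absolutely_continuous_FTC ab acf.
rewrite (fE b) ?ab ?lexx// lerDl /Rintegral.
have F := ae_filter_ringOfSetsType (@lebesgue_measure R).
have igab : (@lebesgue_measure R).-integrable `[a, b] (EFin \o g) by exact: integrableS ig.
have -> : (\int[@lebesgue_measure R]_(x in `[a, b]) (g x)%:E =
    \int[@lebesgue_measure R]_(x in `[a, b]) (EFin \o g)^\+ x)%E.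
  apply: ae_eq_integral => //.
  - exact: measurable_int igab.
  - by apply: measurable_funepos; exact: measurable_int igab.
  - apply: ae_itv_oo; apply: (@filterS2 _ _ F _ _ _ _ df dg) => x hd hg axb.
    have [d [_ dE] d0] := hd axb; have [_ gE] := hg axb.
    by rewrite funeposE max_l// lee_fin -gE dE.
by rewrite fine_ge0// integral_ge0.
Qed.

Lemma last_nonneg (R : realType) (a b : R) (w : R -> R) : a <= b ->
  absolutely_continuous_on a b w -> 0 <= w a -> w b < 0 ->
  exists s, [/\ a <= s, s < b, 0 <= w s & forall t, s < t -> t <= b -> w t < 0].
Proof.
move=> ab acw wa wb; pose S := [set t | a <= t <= b /\ 0 <= w t].
have Sa : S a by rewrite /S/= lexx ab.
have ubS : has_ubound S by exists b => t [/andP[]].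
have supS : has_sup S by split => //; exists a.
have sa : a <= sup S by exact: ub_le_sup.
have sb : sup S <= b by apply: ge_sup; [exists a|move=> t [/andP[]]].
have ws : 0 <= w (sup S).
  (* A negative value at the supremum would persist nearby, where there are points of [S]. *)
  rewrite leNgt; apply/negP => ws.
  have ws' : 0 < - w (sup S) by rewrite oppr_gt0.
  have [d d0 h] := absolutely_continuous_uniform acw ws'.
  have [t [tab wt] ts] := sup_adherent d0 supS.
  have tS : t <= sup S by apply: ub_le_sup => //; split.
  have := h t (sup S) tab; rewrite sa sb ler0_norm ?subr_le0// => /(_ isT).
  move=> /(_ ltac:(lra)); rewrite ltr_norml => /andP[_]; lra.
exists (sup S); split => //.
  by rewrite lt_neqAle sb andbT; apply: contraTneq wb => <-; rewrite -leNgt.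
move=> t st tb; rewrite ltNge; apply/negP => wt.
have : S t by split => //; rewrite tb (le_trans sa)// ltW.
by move=> /(ub_le_sup ubS); rewrite leNgt st.
Qed.

(** After the last time s at which w is nonnegative, w would be negative, hence nondecreasing just
    after s, hence at least w s. The window e depends on s, so that side conditions can be
    maintained by continuity. *)
Lemma nonneg_barrier (R : realType) (a b : R) (w : R -> R) :
  absolutely_continuous_on a b w -> 0 <= w a ->
  (forall s, a <= s -> s < b -> 0 <= w s -> exists2 e, 0 < e &
     {ae @lebesgue_measure R, forall t, s < t < s + e -> t < b -> w t < 0 ->
        exists2 d, is_derive t 1 w d & 0 <= d}) ->
  forall t, a <= t -> t <= b -> 0 <= w t.
Proof.
move=> acw wa dw t at_ tb; rewrite leNgt; apply/negP => wt.
have [s [as_ st ws wneg]] := last_nonneg at_ (absolutely_continuous_onW (lexx a) tb acw) wa wt.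
have [e e0 dwe] := dw s as_ (lt_le_trans st tb) ws.
pose u := Num.min t (s + e).
have su : s < u by rewrite lt_min st ltrDl.
have ut : u <= t by rewrite ge_min lexx.
have acu : absolutely_continuous_on s u w.
  by apply: absolutely_continuous_onW acw => //; exact: le_trans tb.
have := wneg u su ut; rewrite ltNge => /negP; apply; apply: (le_trans ws).
apply: (absolutely_continuous_nondecreasing (ltW su) acu).
have F := ae_filter_ringOfSetsType (@lebesgue_measure R).
apply: (@filterS _ _ F _ _ _ dwe) => x h /andP[sx xu].
have xt := lt_le_trans xu ut.
apply: h; [|exact: lt_le_trans tb|by apply: wneg => //; exact: ltW].
by rewrite sx/= (lt_le_trans xu)// ge_min lexx orbT.
Qed.

(** * The candidate trajectory *)

Section trajectory.
Variables (R : realType) (T theta r alpha : R) (gam Gam : R -> R -> R).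
Hypothesis T_gt0 : 0 < T.
Hypothesis theta_gt0 : 0 < theta.
Hypothesis r_gt0 : 0 < r.
Hypothesis alpha_gt1 : 1 < alpha.
Hypothesis gamP : discount_function T gam.
Hypothesis GamP : discount_antiderivative T alpha gam Gam.
Hypothesis zeta_noninc : forall s t : R, 0 <= s -> s <= t -> t <= T ->
  zeta T alpha gam Gam t <= zeta T alpha gam Gam s.

Let Z := zeta T alpha gam Gam.
Let g := gap T theta Gam.
Let g_gt0 t : 0 <= t -> t < T -> 0 < g t.
Proof. exact: (gap_gt0 T_gt0 theta_gt0 alpha_gt1 gamP GamP). Qed.

Let D_gt0 t : 0 <= t -> t < T -> 0 < horizon T Gam t.
Proof. exact: (horizon_gt0 alpha_gt1 gamP GamP). Qed.

Let g_derive t : 0 < t -> t < T -> is_derive t 1 g (- (g t / horizon T Gam t)).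
Proof. exact: (gap_derive theta T_gt0 alpha_gt1 gamP GamP). Qed.

Let g_nonincreasing s t : 0 <= s -> s <= t -> t <= T -> g t <= g s.
Proof. exact: (gap_nonincreasing T_gt0 theta_gt0 alpha_gt1 gamP GamP). Qed.

Let g_end : g T = 0.
Proof. exact: (gap_end theta T_gt0 alpha_gt1 gamP GamP). Qed.

Let g_start : g 0 = theta.
Proof. exact: (gap0 theta T_gt0 alpha_gt1 gamP GamP). Qed.

Let g_continuous : {within `[0, T], continuous g}.
Proof. exact: (gap_within_continuous T_gt0 theta_gt0 alpha_gt1 gamP GamP). Qed.

Let g_ge0 t : 0 <= t -> t <= T -> 0 <= g t.
Proof. by move=> t0 tT; rewrite -g_end; apply: g_nonincreasing. Qed.

Let alpha_gt0 : 0 < alpha. Proof. exact: lt_trans alpha_gt1. Qed.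

(** On [0, c] the gap is at most theta and the horizon at least T - c, which bounds the slope of
    [g]. *)
Lemma gap_lipschitz c p q : 0 <= p -> p <= q -> q <= c -> c < T ->
  g p - g q <= theta / (T - c) * (q - p).
Proof.
move=> p0 pq qc cT; have Tc : 0 < T - c by rewrite subr_gt0.
set K := theta / (T - c).
have c0 : 0 <= c by rewrite (le_trans p0)// (le_trans pq).
pose f s := g s + K * s.
have df s : 0 < s -> s < T -> is_derive s 1 f (- (g s / horizon T Gam s) + K).
  move=> s0 sT; have := is_deriveD (g_derive s0 sT) (is_deriveZ K (is_derive_id s 1)).
  by rewrite /GRing.scale/= mulr1.
have cf : {within `[0, c], continuous f}.
  have sub : `[0, c] `<=` `[0, T].
    by move=> s /=; rewrite !in_itv/= => /andP[-> /le_trans]; apply; exact: ltW.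
  move=> s; apply: cvgD; first exact: (continuous_subspaceW sub g_continuous).
  apply: cvgMr; move: s; apply: continuous_subspaceT => s; exact: cvg_id.
have : f p <= f q.
  apply: (ger0_derive1_le_cc _ _ cf) => //;
    rewrite ?in_itv/= ?p0 ?qc ?(le_trans pq)// ?(le_trans p0)//.
  - by move=> s; rewrite in_itv/= => /andP[s0 sc]; have [] := df s s0 (lt_trans sc cT).
  - move=> s; rewrite in_itv/= => /andP[s0 sc]; have sT := lt_trans sc cT.
    have [_ dE] := df s s0 sT; rewrite derive1E dE addrC subr_ge0 /K.
    have s0' := ltW s0; have sT' := ltW sT.
    apply: ler_pM; rewrite ?g_ge0 ?invr_ge0 ?(ltW (D_gt0 _ _))//.
      by rewrite -g_start g_nonincreasing.
    rewrite lef_pV2 ?posrE ?D_gt0//.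
    apply: le_trans (horizon_ge alpha_gt1 gamP GamP _); last by rewrite s0'.
    by rewrite lerB// ltW.
by rewrite /f; lra.
Qed.

Lemma gap_absolutely_continuous c : c < T -> absolutely_continuous_on 0 c g.
Proof.
move=> cT; apply: (@lipschitz_absolutely_continuous _ _ _ (theta / (T - c))) => p q p0 pq qc.
have pT : q <= T by rewrite (le_trans qc)// ltW.
by rewrite distrC ger0_norm ?subr_ge0 ?g_nonincreasing// gap_lipschitz.
Qed.

(** The positive denominators are cleared; theta^alpha exp(- alpha I) is the gap raised to the power
    alpha. *)
Let abandonedE t : 0 <= t -> t < T ->
  (r / theta `^ alpha < fine (expeR (- (alpha%:E * rate_integral T Gam t))%E) / Z t)
  <-> (r * Z t < g t `^ alpha).
Proof.
move=> t0 tT.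
have rE := rate_integralE T_gt0 alpha_gt1 gamP GamP t0 tT.
rewrite /g /gap rE /= powRM ?(ltW theta_gt0) ?expR_ge0//.
set i := (X in expR (- X) `^ _).
have -> : expR (- i) `^ alpha = expR (- (alpha * i)).
  by rewrite /powR (gt_eqF (expR_gt0 _)) expRK mulrN.
have A0 : 0 < theta `^ alpha by rewrite powR_gt0.
have Z0 : 0 < Z t.
  rewrite /Z /zeta mulr_gt0 ?powR_gt0 ?D_gt0//.
  by case/andP: (discount_range gamP t0 (ltW tT) (lexx T)).
by rewrite ltr_pdivrMr// mulrAC ltr_pdivlMr// mulrC (mulrC _ (theta `^ alpha)).
Qed.

Lemma abandonment_setE t : abandonment_set T theta r alpha gam Gam t <->
  [/\ 0 <= t, t < T & r * Z t < g t `^ alpha].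
Proof.
rewrite /abandonment_set /=; split.
  move=> [/andP[t0]]; rewrite le_eqVlt => /predU1P[->|tT].
    rewrite /zeta subrr powR0 ?gt_eqF ?subr_gt0// mulr0 invr0 mulr0.
    by rewrite ltNge divr_ge0// ?powR_ge0// ltW.
  by move=> /(abandonedE t0 tT).
by move=> [t0 tT /(abandonedE t0 tT)]; rewrite t0 ltW.
Qed.

Let ts := abandonment_time T theta r alpha gam Gam.
Let S := abandonment_set T theta r alpha gam Gam.

Let lbS : has_lbound S.
Proof. by exists 0 => t /abandonment_setE[]. Qed.

Lemma abandonment_time_in : 0 <= ts <= T.
Proof.
rewrite /ts /abandonment_time -/S; case: asboolP => [S0|_]; last by rewrite lexx ltW.
apply/andP; split.
  by apply: lb_le_inf => // t /abandonment_setE[].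
have [t St] := S0; have [_ /ltW tT _] := (abandonment_setE t).1 St.
by apply: le_trans tT; exact: ge_inf.
Qed.

Lemma before_abandonment t : 0 <= t -> t < ts -> g t `^ alpha <= r * Z t.
Proof.
move=> t0 tts; have /andP[_ tsT] := abandonment_time_in.
rewrite leNgt; apply/negP => h.
have St : S t by apply/abandonment_setE; split => //; exact: lt_le_trans tsT.
move: tts; rewrite /ts /abandonment_time -/S; case: asboolP => [_|]; last by case; exists t.
by rewrite ltNge ge_inf.
Qed.

(** The infimum need not be attained, so [s] is a member of the set close to it; if the set is
    empty, no time is left after T. *)
Lemma after_abandonment t : ts < t -> t <= T ->
  exists s, [/\ ts <= s, s < t & r * Z s < g s `^ alpha].
Proof.
rewrite /ts /abandonment_time -/S; case: asboolP => [S0 tt tT|_ h tT]; last first.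
  by move: h; rewrite ltNge tT.
have [s Ss st] := inf_lt S0 tt.
by exists s; split => //; [exact: ge_inf|have [] := (abandonment_setE s).1 Ss].
Qed.

Definition trajectory (t : R) : R := theta - g (Num.min t ts).

Let trajectory_nondecreasing p q : 0 <= p -> p <= q -> q <= T ->
  trajectory p <= trajectory q.
Proof.
move=> p0 pq qT; have /andP[ts0 tsT] := abandonment_time_in.
rewrite lerB// g_nonincreasing ?le_min ?p0 ?ts0//.
  by rewrite !ge_min pq lexx orbT.
by rewrite ge_min qT.
Qed.

Lemma trajectory_absolutely_continuous : absolutely_continuous_on 0 T trajectory.
Proof.
have /andP[ts0 tsT] := abandonment_time_in.
apply: nondecreasing_absolutely_continuous => //.
- move=> c c0 cT; apply: (@lipschitz_absolutely_continuous _ _ _ (theta / (T - c))) => p q p0 pq qc.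
  have qT : q <= T by rewrite (le_trans qc)// ltW.
  rewrite ger0_norm ?subr_ge0 ?trajectory_nondecreasing//.
  rewrite (_ : _ - _ = g (Num.min p ts) - g (Num.min q ts)); last by rewrite /trajectory; ring.
  have mm : Num.min p ts <= Num.min q ts by rewrite le_min !ge_min pq lexx orbT.
  apply: (le_trans (gap_lipschitz _ mm _ cT)).
  - by rewrite le_min p0.
  - by rewrite ge_min qc.
  - apply: ler_wpM2l; first by rewrite divr_ge0 ?subr_ge0 ?ltW.
    by rewrite /Order.min; do 2 case: ifPn; rewrite -?leNgt => *; lra.
(* If [ts] is T, continuity of [g] at T makes the last increments small; otherwise the trajectory is
   constant from [ts] on and c = ts works. *)
- move=> e e0; move: tsT; rewrite le_eqVlt => /predU1P[tsT|tsT].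
    have /subspace_continuousP/(_ T) := g_continuous.
    rewrite /= in_itv/= lexx (ltW T_gt0) => /(_ isT) /cvgrPdist_lt /(_ e e0).
    rewrite near_withinE => -[d /= d0 hd].
    pose c := Num.max 0 (T - d / 2).
    have cT : c < T by rewrite gt_max T_gt0/= gtrBl divr_gt0.
    have c0 : 0 <= c by rewrite le_max lexx.
    exists c; split => //; rewrite /trajectory tsT minxx (min_l (ltW cT)) g_end.
    have := hd c; rewrite /= gtr0_norm ?subr_gt0// in_itv/= c0 (ltW cT).
    have cd : T - d / 2 <= c by rewrite le_max lexx orbT.
    move=> /(_ ltac:(lra) isT).
    change (`|g T - g c| < e -> theta - 0 - (theta - g c) < e).
    rewrite g_end sub0r normrN => /(le_lt_trans (ler_norm _)); lra.
  by exists ts; split => //; rewrite /trajectory minxx (min_r (ltW tsT)) subrr.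
Qed.

Let Z_noninc s t (s0 : 0 <= s) (st : s <= t) (tT : t <= T) : r * Z t <= r * Z s :=
  ler_wpM2l (ltW r_gt0) (zeta_noninc s0 st tT).

(** Before [ts] the goal is worthwhile. Afterwards the gap is frozen at g ts, at least the gap at
    some earlier time s of the abandonment set, and zeta has not increased since s. The kink at [ts]
    is a null set. *)
Lemma trajectory_follows : follows_selected_plans T theta r alpha gam trajectory.
Proof.
have /andP[ts0 tsT] := abandonment_time_in; split.
- exact: trajectory_absolutely_continuous.
- by rewrite /trajectory min_l// g_start subrr.
have F := ae_filter_ringOfSetsType (@lebesgue_measure R).
apply: (@filterS _ _ F _ _ _ (ae_neq ts)) => t tts /andP[t0 tT].
have [tlt|tgt|/eqP] := ltgtP t ts; last by rewrite (negbTE tts).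
  have xE : trajectory t = theta - g t by rewrite /trajectory min_l// ltW.
  have xlt : trajectory t < theta by rewrite xE gtrBl g_gt0// ltW.
  have gE : theta - trajectory t = g t by rewrite xE opprB addrCA subrr addr0.
  have cheap : (theta - trajectory t) `^ alpha <= r * zeta T alpha gam Gam t.
    by rewrite gE before_abandonment// ltW.
  have sel := selected_goal_plan alpha_gt1 gamP GamP (ltW t0) tT xlt cheap.
  eexists; eexists; split; first exact: sel.
  rewrite gE; have dg := is_deriveB (is_derive_cst theta t 1) (g_derive t0 tT).
  rewrite sub0r opprK in dg; apply: near_eq_is_derive dg; near=> s.
  rewrite /trajectory min_l//; apply: ltW; near: s; exact: lt_nbhsl.
have tsT' : ts < T := lt_trans tgt tT.
have xE : trajectory t = theta - g ts by rewrite /trajectory min_r// ltW.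
have xlt : trajectory t < theta by rewrite xE gtrBl g_gt0.
have [s [tss st Zs]] := after_abandonment tgt (ltW tT).
have s0 := le_trans ts0 tss.
have dear : r * zeta T alpha gam Gam t < (theta - trajectory t) `^ alpha.
  rewrite xE opprB addrCA subrr addr0.
  apply: le_lt_trans (Z_noninc s0 (ltW st) (ltW tT)) _; apply: (lt_le_trans Zs).
  have sT : s <= T by rewrite ltW// (lt_trans st).
  by apply: ge0_ler_powR; rewrite ?nnegrE ?(ltW alpha_gt0) ?g_ge0 ?g_nonincreasing.
have sel := selected_constant_plan alpha_gt1 gamP GamP (ltW t0) tT xlt dear.
exists (cst (trajectory t)), 0; split; first exact: sel.
apply: near_eq_is_derive (is_derive_cst (trajectory t) t 1); near=> u.
rewrite xE /trajectory min_r//; apply: ltW; near: u; exact: lt_nbhsr.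
Unshelve. all: by end_near. Qed.

(** * Comparison with an arbitrary solution *)

Section comparison.
Variable z : R -> R.
Hypothesis zP : follows_selected_plans T theta r alpha gam z.

Let acz : absolutely_continuous_on 0 T z. Proof. by case: zP. Qed.

(** Barrier argument for the excess of theta - z over [g]: where it is negative, z moves at rate at
    most (theta - z) / D < g / D, so the excess cannot decrease. *)
Let gap_le t : 0 <= t -> t < T -> g t <= theta - z t.
Proof.
move=> t0 tT; rewrite -subr_ge0; pose w s := theta - z s - g s.
have accst c : absolutely_continuous_on 0 t (cst c).
  apply: (@lipschitz_absolutely_continuous _ _ _ 0) => p q _ _ _.
  by rewrite subrr normr0 mul0r.
have aczt := absolutely_continuous_onW (lexx 0) (ltW tT) acz.
have acw : absolutely_continuous_on 0 t w.
  apply: absolutely_continuous_onB; last exact: gap_absolutely_continuous.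
  exact: (absolutely_continuous_onB (accst theta) aczt).
apply: (nonneg_barrier acw) => //.
  by case: zP => _ z0 _; rewrite /w z0 g_start subr0 subrr.
move=> s s0 st; rewrite /w subr_ge0 => gs.
have vs : 0 < theta - z s by apply: lt_le_trans gs; rewrite g_gt0// (lt_trans st).
(* On this window z stays below theta, as the bound on optimal slopes requires. *)
have [e e0 he] := absolutely_continuous_uniform aczt vs; exists e => //.
have F := ae_filter_ringOfSetsType (@lebesgue_measure R).
case: zP => _ _; apply: (@filterS _ _ F) => u hu /andP[su ue] ut wu.
have u0 : 0 < u := le_lt_trans s0 su; have uT := lt_trans ut tT.
have zu : z u < theta.
  have := he u s; rewrite s0 !ltW// gtr0_norm ?subr_gt0// => /(_ isT isT).
  move=> /(_ ltac:(lra)) /(le_lt_trans (ler_norm _)); lra.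
have [|y [d [[opt dy _] dz]]] := hu; first by rewrite u0.
have dle := optimal_plan_derivative_le alpha_gt1 gamP GamP (ltW u0) uT zu opt dy.
exists (- d - - (g u / horizon T Gam u)).
  have := is_deriveB (is_deriveB (is_derive_cst theta u 1) dz) (g_derive u0 uT).
  by rewrite sub0r.
have D0 := D_gt0 (ltW u0) uT.
have : (theta - z u) / horizon T Gam u <= g u / horizon T Gam u.
  by rewrite ler_pM2r ?invr_gt0// ltW// -subr_lt0.
by move: dle; rewrite -/(horizon T Gam u); lra.
Qed.

(** Barrier argument for z s - z: while z has not passed z s by much, the goal stays too expensive
    and the selected slope is at most 0. *)
Let abandoned_stays s t : 0 <= s -> s < T -> r * Z s < (theta - z s) `^ alpha ->
  s <= t -> t <= T -> theta - z s <= theta - z t.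
Proof.
move=> s0 sT dear st tT; rewrite -subr_ge0; pose w u := z s - z u.
rewrite (_ : _ - _ = w t); last by rewrite /w; ring.
have aczs := absolutely_continuous_onW s0 (lexx T) acz.
have acw : absolutely_continuous_on s T w.
  apply: absolutely_continuous_onB => //.
  apply: (@lipschitz_absolutely_continuous _ _ _ 0) => p q _ _ _.
  by rewrite subrr normr0 mul0r.
have v0 : 0 < theta - z s by apply: lt_le_trans (gap_le s0 sT); exact: g_gt0.
have Zs0 : 0 <= r * Z s.
  by rewrite mulr_ge0 ?(ltW r_gt0)// /Z/zeta mulr_ge0 ?powR_ge0// ltW//;
     case/andP: (discount_range gamP s0 (ltW sT) (lexx T)).
(* The largest worthwhile gap at time s. As zeta is non-increasing, a gap above [k] is too large at
   every later time as well. *)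
pose k := (r * Z s) `^ alpha^-1.
have k0 : 0 <= k by exact: powR_ge0.
have kE : k `^ alpha = r * Z s.
  by rewrite /k -powRrM mulVf ?gt_eqF// powRr1.
have kv : k < theta - z s.
  rewrite ltNge; apply/negP => h; move: dear; rewrite -kE ltNge => /negP; apply.
  by apply: ge0_ler_powR => //; rewrite ?nnegrE ltW.
apply: (nonneg_barrier acw) => //; first by rewrite /w subrr.
move=> a sa aT; rewrite /w subr_ge0 => za.
have kva : 0 < theta - z a - k by lra.
have [e e0 he] := absolutely_continuous_uniform aczs kva; exists e => //.
have F := ae_filter_ringOfSetsType (@lebesgue_measure R).
case: zP => _ _; apply: (@filterS _ _ F) => u hu /andP[au ue] uT wu.
have su : s < u := le_lt_trans sa au; have u0 : 0 < u := le_lt_trans s0 su.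
have ku : k < theta - z u.
  have := he u a; rewrite sa !ltW// gtr0_norm ?subr_gt0// => /(_ isT isT).
  move=> /(_ ltac:(lra)) /(le_lt_trans (ler_norm _)); lra.
have zu : z u < theta by lra.
have [|y [d [[opt dy _] dz]]] := hu; first by rewrite u0.
have dearu : r * zeta T alpha gam Gam u < (theta - z u) `^ alpha.
  apply: le_lt_trans (Z_noninc s0 (ltW su) (ltW uT)) _; rewrite -kE.
  by apply: gt0_ltr_powR => //; rewrite nnegrE// ltW// (le_lt_trans k0).
have d0 := optimal_plan_derivative_le0 alpha_gt1 gamP GamP (ltW u0) uT zu dearu opt dy.
exists (- d); last by rewrite oppr_ge0.
by have := is_deriveB (is_derive_cst (z s) u 1) dz; rewrite sub0r.
Qed.

(** Up to [ts] this is [gap_le], extended to T by continuity of z. Beyond it, z is stuck from some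
    abandoned time s on at a gap of at least g s, where s is so close to [ts] that g s differs from
    g ts by less than [e]. *)
Lemma trajectory_greatest t : 0 <= t <= T -> z t <= trajectory t.
Proof.
move=> /andP[t0 tT]; have /andP[ts0 tsT] := abandonment_time_in.
rewrite /trajectory lerBrDr -lerBrDl.
have [tlt|tgt] := leP t ts.
  move: tT; rewrite le_eqVlt => /predU1P[tT|tT]; last first.
    by have := gap_le t0 tT; lra.
  rewrite tT g_end; apply/ler_addgt0Pr => e e0.
  have [d d0 hd] := absolutely_continuous_uniform acz e0.
  pose c := Num.max 0 (T - d / 2).
  have cT : c < T by rewrite gt_max T_gt0/= gtrBl divr_gt0.
  have c0 : 0 <= c by rewrite le_max lexx.
  have cd : T - d / 2 <= c by rewrite le_max lexx orbT.
  have := hd T c; rewrite lexx c0 (ltW T_gt0) (ltW cT) gtr0_norm ?subr_gt0// => /(_ isT isT).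
  move=> /(_ ltac:(lra)) /(le_lt_trans (ler_norm _)).
  have := gap_le c0 cT; have := g_gt0 c0 cT; lra.
have tsT' := lt_le_trans tgt tT.
apply/ler_addgt0Pr => e e0.
have /subspace_continuousP/(_ ts) := g_continuous.
rewrite /= in_itv/= ts0 tsT => /(_ isT) /cvgrPdist_lt /(_ e e0).
rewrite near_withinE => -[d /= d0 hd].
have [||s [tss st Zs]] := @after_abandonment (Num.min t (ts + d)).
- by rewrite lt_min tgt ltrDl.
- by rewrite ge_min tT.
move: st; rewrite lt_min => /andP[st sd].
have s0 := le_trans ts0 tss; have sT := lt_le_trans st tT.
have := hd s; rewrite /= distrC ger0_norm ?subr_ge0// in_itv/= s0 (ltW sT).
move=> /(_ ltac:(lra) isT).
change (`|g ts - g s| < e -> g ts <= theta - z t + e).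
move=> /(le_lt_trans (ler_norm _)) ge.
have gs := gap_le s0 sT.
have dear : r * Z s < (theta - z s) `^ alpha.
  apply: (lt_le_trans Zs); apply: ge0_ler_powR; rewrite ?nnegrE ?(ltW alpha_gt0)//.
    exact: ltW (g_gt0 s0 sT).
  by apply: le_trans gs; exact: ltW (g_gt0 s0 sT).
by have := abandoned_stays s0 sT dear (ltW st) tT; lra.
Qed.

End comparison.

End trajectory.

Lemma follows_selected_plans_eq (R : realType) (T theta r alpha : R)
    (gam : R -> R -> R) (x z : R -> R) :
  0 <= T -> (forall t, 0 <= t <= T -> x t = z t) ->
  follows_selected_plans T theta r alpha gam z ->
  follows_selected_plans T theta r alpha gam x.
Proof.
move=> T0 xz [acz z0 dz]; split.
- move=> e e0; have [d d0 h] := acz e e0; exists d => // n l u lu tlu sd.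
  under eq_bigr => i _.
    have /and3P[li lui ui] := lu i.
    rewrite !xz ?li ?ui ?(le_trans li)//; last exact: le_trans ui.
    over.
  exact: h.
- by rewrite xz ?lexx.
have F := ae_filter_ringOfSetsType (@lebesgue_measure R).
apply: (@filterS _ _ F _ _ _ dz) => t + /andP[t0 tT] => /(_ ltac:(by rewrite t0)).
move=> [y [d [sel dzt]]]; exists y, d; split; first by rewrite xz// !ltW.
apply: near_eq_is_derive dzt; near=> s; rewrite xz//.
by apply/andP; split; apply: ltW; near: s; [exact: lt_nbhsr|exact: lt_nbhsl].
Unshelve. all: by end_near. Qed.

Theorem theorem1 (R : realType) (T theta r alpha : R) (gam Gam : R -> R -> R)
    (T_gt0 : 0 < T) (theta_gt0 : 0 < theta) (r_gt0 : 0 < r)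
    (alpha_gt1 : 1 < alpha)
    (gamP : discount_function T gam)
    (GamP : discount_antiderivative T alpha gam Gam)
    (zeta_noninc : forall s t : R, 0 <= s -> s <= t -> t <= T ->
       zeta T alpha gam Gam t <= zeta T alpha gam Gam s)
    (x : R -> R) :
  agent_trajectory T theta r alpha gam x <->
  forall t : R, 0 <= t <= T ->
    x t = theta * (1 - fine (expeR (- rate_integral T Gam
            (Num.min t (abandonment_time T theta r alpha gam Gam)))%E)).
Proof.
have xE t : theta * (1 - fine (expeR (- rate_integral T Gam
    (Num.min t (abandonment_time T theta r alpha gam Gam)))%E)) =
    trajectory T theta r alpha gam Gam t.
  by rewrite /trajectory /gap mulrBr mulr1.
have sol := trajectory_follows T_gt0 theta_gt0 r_gt0 alpha_gt1 gamP GamP zeta_noninc.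
have max z := @trajectory_greatest R T theta r alpha gam Gam T_gt0 theta_gt0 r_gt0
  alpha_gt1 gamP GamP zeta_noninc z.
split=> [[xP xmax] t tT|xt].
  (* Two greatest solutions dominate each other on [0, T]. *)
  by rewrite xE; apply/le_anti; rewrite max//= xmax.
have xt' t : 0 <= t <= T -> x t = trajectory T theta r alpha gam Gam t.
  by move=> tT; rewrite xt// xE.
split=> [|z zP t tT]; last by rewrite xt'// max.
exact: follows_selected_plans_eq (ltW T_gt0) xt' sol.
Qed.
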